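(* Let $H$ be a separable infinite-dimensional complex Hilbert space. For every bounded self-adjoint operator $A$ on $H$ there exist real numbers $\alpha_1,\dots,\alpha_5$ and proper orthoprojections $P_1,\dots,P_5$ on $H$ such that $A=\sum_{i=1}^{5}\alpha_iP_i$.
   Context: An orthoprojection on $H$ is a bounded operator $P$ on $H$ with $P=P^*=P^2$. An orthoprojection $P$ is called proper if $\dim \operatorname{Im} P=\dim \operatorname{Im}(I-P)=\infty$, where $I$ is the identity operator on $H$. *)

(* Defs.v *)
From HB Require Import structures.
From mathcomp Require Import all_boot all_order all_algebra.
From mathcomp Require Import complex.
From mathcomp Require Import all_classical all_reals all_analysis.

Set Implicit Arguments.
Unset Strict Implicit.
Unset Printing Implicit Defensive.

Import Order.TTheory GRing.Theory Num.Theory.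
Import numFieldNormedType.Exports.

Local Open Scope classical_set_scope.
Local Open Scope ring_scope.
Local Open Scope complex_scope.

(* A complex Hilbert space is a complete normed module over R[i] together with
   a positive definite hermitian form (linear in its first argument) inducing
   its norm, which takes values in R[i]. *)
Definition induces_norm (R : realType) (H : completeNormedModType R[i])
    (dot : {dot H for Num.conj}) : Prop :=
  forall x : H, `|x| ^+ 2 = dot x x.

Definition separable (T : topologicalType) : Prop :=
  exists2 D : set T, countable D & dense D.

(* Algebraic dimension. A Hilbert space, or a closed subspace of it, is infinite
   dimensional in this sense iff its orthonormal bases are infinite. *)
Definition finite_dimensional (K : fieldType) (V : lmodType K) (S : set V) :
    Prop :=
  exists (n : nat) (e : 'I_n -> V), (forall i, S (e i)) /\
    (forall x, S x -> exists c : 'I_n -> K, x = \sum_(i < n) c i *: e i).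

Definition infinite_dimensional (K : fieldType) (V : lmodType K) (S : set V) :
    Prop :=
  ~ finite_dimensional S.

Section operators.
Context (R : realType) (H : completeNormedModType R[i]).
Implicit Types (dot : {dot H for Num.conj}) (A B P : {linear H -> H}).

Definition bounded_operator A : Prop :=
  exists M : R, forall x : H, `|A x| <= M%:C * `|x|.

Definition is_adjoint dot A B : Prop :=
  forall x y : H, dot (A x) y = dot x (B y).

Definition self_adjoint dot A : Prop := is_adjoint dot A A.

Definition orthoprojection dot P : Prop :=
  [/\ bounded_operator P, self_adjoint dot P & forall x, P (P x) = P x].

Definition proper_orthoprojection dot P : Prop :=
  [/\ orthoprojection dot P,
      infinite_dimensional (range P) &
      infinite_dimensional (range (fun x => x - P x))].

End operators.

(* Main.v *)
From HB Require Import structures.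
Require Import Defs.
From mathcomp Require Import all_boot all_order all_algebra.
From mathcomp Require Import complex.
From mathcomp Require Import all_classical all_reals all_analysis.
From mathcomp Require Import ring lra zify.

Import Order.TTheory GRing.Theory Num.Theory.
Import numFieldNormedType.Exports.

Local Open Scope classical_set_scope.
Local Open Scope ring_scope.
Local Open Scope complex_scope.

(** Why the theorem is true.  Call a self-adjoint operator of square 1 a symmetry.
If [B] is self-adjoint of norm at most 1/2 and anticommutes with a symmetry [J],
then [S], the square root of [1 - B^2], commutes with both, so [B + J S] and
[B - J S] are symmetries, and [P = (1 + B + J S) / 2], [Q = (1 + B - J S) / 2]
are orthoprojections with [P + Q = 1 + B].  Each of [P], [Q], [1 - P], [1 - Q] is
injective on one eigenspace of [J], so [P] and [Q] are proper once both eigenspaces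
are infinite dimensional ([projection_pair], and its rescaling
[scaled_projection_pair]).  This is used three times.

The first use spends one projection on making [A] partly diagonal
([eigenvector_reduction]).  Choose unit vectors [a n], each orthogonal to the
vectors [a m], [A (a m)] and [A (A (a m))] for [m < n].  Let [E] be the projection
onto the closed span of the [e n := a n.*2] and [J = 2 E - 1]; the odd-numbered
[a n] make the other eigenspace of [J] infinite dimensional.  The off-diagonal part
[B] of [A] with respect to [E] anticommutes with [J], hence for large [mu] the
operator [C = A - 2 mu P] has no off-diagonal part.  By the choice of [a n], each
[e n] is an eigenvector of [E A] and of [B^2], hence of [S], and finally of [C].

It remains to write [C] with four projections.  Along a subsequence its eigenvalues
converge to some [d], as fast as wanted.  Arrange that subsequence in a double array
and complete it to an orthonormal basis [g (k, n)] of [H] such that, for [k > 0],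
[g (k, n)] is an eigenvector of [D = C - d] for an eigenvalue of modulus at most
[2^-k]; the level [k = 0] carries an arbitrary self-adjoint block [D0].  With
[T k = D0 + (the sum of the diagonal blocks of D at the levels 1, ..., k)], all
read on level 0 and uniformly bounded, the swindle
[[
  D = diag(T 0, - T 0, T 2, - T 2, ...) + diag(0, T 1, - T 1, T 3, - T 3, ...)
]]
writes [D] as the sum of two operators [B1], [B2], each of which anticommutes with
the symmetry exchanging the paired levels.  The device gives
[mu (P1 + Q1) = mu + B1] and [nu (P2 + Q2) = nu + B2]; only [`|mu|] and [`|nu|]
have to be large, so [mu + nu = d] can be imposed and the four projections sum up
to [d + D = C] ([four_projections]).  *)

(** * Norm and inner product *)

Section norm_and_inner_product.
Context {R : realType} {H : completeNormedModType R[i]}.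
Context {dot : {dot H for Num.conj}}.
Implicit Types (x y z : H) (F G : {linear H -> H}).

(** The norm of the space takes its values in [R[i]]; its real part is the same number
in [R], where order reasoning and linear arithmetic are available. *)
Definition nrm (x : H) : R := complex.Re `|x|.

Lemma nrmE x : `|x| = (nrm x)%:C.
Proof. by rewrite /nrm RRe_real // normr_real. Qed.

Lemma nrm_ge0 x : 0 <= nrm x.
Proof. by rewrite -lecR -nrmE; exact: normr_ge0. Qed.

Lemma nrm_eq0 x : nrm x = 0 -> x = 0.
Proof. by move=> x0; apply/eqP; rewrite -normr_eq0 nrmE x0. Qed.

Lemma nrm0 : nrm 0 = 0.
Proof. by apply: complexI; rewrite -nrmE normr0. Qed.

Lemma nrmN x : nrm (- x) = nrm x.
Proof. by rewrite /nrm normrN. Qed.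

Lemma nrmD x y : nrm (x + y) <= nrm x + nrm y.
Proof. by rewrite -lecR rmorphD /= -!nrmE ler_normD. Qed.

Lemma nrmB x y : nrm (x - y) <= nrm x + nrm y.
Proof. by rewrite -(nrmN y) nrmD. Qed.

Lemma nrmZ (a : R) x : nrm (a%:C *: x) = `|a| * nrm x.
Proof.
apply: complexI; rewrite rmorphM /= -!nrmE normrZ; congr (_ * _).
by rewrite normc_def /= expr0n addr0 sqrtr_sqr.
Qed.

Lemma nrmcZ (a : R[i]) x : nrm (a *: x) = complex.Re `|a| * nrm x.
Proof.
apply: complexI; rewrite rmorphM /= -!nrmE normrZ; congr (_ * _).
Qed.

Lemma bounded_nrmP F :
  bounded_operator F <-> exists M : R, forall x, nrm (F x) <= M * nrm x.
Proof.
split=> -[M HM]; exists M => x; last by rewrite !nrmE -rmorphM lecR.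
by rewrite -lecR rmorphM /= -!nrmE.
Qed.

Lemma dotDl x y z : dot (x + y) z = dot x z + dot y z.
Proof. exact: linearDl. Qed.
Lemma dotDr x y z : dot z (x + y) = dot z x + dot z y.
Proof. exact: linearDr. Qed.
Lemma dotNl x z : dot (- x) z = - dot x z.
Proof. exact: linearNl. Qed.
Lemma dotNr x z : dot z (- x) = - dot z x.
Proof. exact: linearNr. Qed.
Lemma dotBl x y z : dot (x - y) z = dot x z - dot y z.
Proof. exact: linearBl. Qed.
Lemma dotBr x y z : dot z (x - y) = dot z x - dot z y.
Proof. exact: linearBr. Qed.
Lemma dotZl (a : R[i]) x z : dot (a *: x) z = a * dot x z.
Proof. exact: linearZl_LR. Qed.
Lemma dotZr (a : R[i]) x z : dot z (a *: x) = (a^*)%R * dot z x.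
Proof. exact: linearZr_LR. Qed.
Lemma dot0l z : dot 0 z = 0.
Proof. exact: linear0l. Qed.
Lemma dot0r z : dot z 0 = 0.
Proof. exact: linear0r. Qed.
Lemma dot_suml I (r : seq I) (P : pred I) (f : I -> H) z :
  dot (\sum_(i <- r | P i) f i) z = \sum_(i <- r | P i) dot (f i) z.
Proof. exact: linear_sumlz. Qed.
Lemma dot_sumr I (r : seq I) (P : pred I) (f : I -> H) z :
  dot z (\sum_(i <- r | P i) f i) = \sum_(i <- r | P i) dot z (f i).
Proof. exact: linear_sumr. Qed.

Lemma dotC x y : dot x y = ((dot y x)^*)%R.
Proof. by rewrite (hermC dot x y) expr0 mul1r. Qed.

Lemma dot_eq0C x y : dot x y = 0 -> dot y x = 0.
Proof. by move=> xy0; rewrite dotC xy0 rmorph0. Qed.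

Lemma dotr0_eq0 x : (forall y, dot x y = 0) -> x = 0.
Proof. by move/(_ x)/eqP; rewrite dnorm_eq0 => /eqP. Qed.

(** Together with [dot_lin] this turns an identity between linear combinations of
vectors into an identity in the field [R[i]], which [ring] decides. *)
Lemma dot_ext x y : (forall z, dot x z = dot y z) -> x = y.
Proof.
move=> xy; apply/eqP; rewrite -subr_eq0; apply/eqP/dotr0_eq0 => z.
by rewrite dotBl xy subrr.
Qed.

Definition dot_lin := (dotDl, dotBl, dotNl, dotZl, dot0l).

Context (dot_norm : induces_norm dot).

Lemma dotxx x : dot x x = (nrm x ^+ 2)%:C.
Proof. by rewrite -dot_norm nrmE rmorphXn. Qed.

Lemma nrm_sqrE x : nrm x ^+ 2 = complex.Re (dot x x).
Proof. by rewrite dotxx. Qed.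

Lemma nrm_sqrD x y : dot x y = 0 -> nrm (x + y) ^+ 2 = nrm x ^+ 2 + nrm y ^+ 2.
Proof.
move=> xy0; apply: complexI.
by rewrite rmorphD /= -!dotxx dotDl !dotDr xy0 (dot_eq0C _ _ xy0) addr0 add0r.
Qed.

Lemma cauchy_schwarz x y : `|dot x y| <= (nrm x * nrm y)%:C.
Proof.
have [->|y0] := eqVneq y 0; first by rewrite dot0r normr0 nrm0 mulr0.
have yy : 0 < dot y y by rewrite dnorm_gt0.
pose t := dot x y / dot y y.
have : 0 <= dot (x - t *: y) (x - t *: y) by exact: dnorm_ge0.
rewrite dotBl !dotBr !dotZl !dotZr.
have -> : (t^*)%R * dot x y = `|dot x y| ^+ 2 / dot y y.
  by rewrite /t rmorphM fmorphV /= -(dotC y y) mulrAC [_ * dot x y]mulrC normCK.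
have -> : t * (dot y x) = `|dot x y| ^+ 2 / dot y y.
  by rewrite (dotC y x) /t mulrAC normCK.
have -> : t * ((t^*)%R * dot y y) = `|dot x y| ^+ 2 / dot y y.
  rewrite mulrA -normCK /t normrM exprMn normfV (gtr0_norm yy) -mulrA; congr (_ * _).
  by field; rewrite gt_eqF.
rewrite subrr subr0 subr_ge0 ler_pdivrMr // !dotxx -!rmorphM /= -!exprMn => h.
rewrite -(@ler_pXn2r _ 2) ?nnegrE // ?ler0c ?mulr_ge0 ?nrm_ge0 //.
by move: h; rewrite rmorphXn.
Qed.

End norm_and_inner_product.

(** * Strong limits of operators *)

Section strong_limits.
Context {R : realType} {H : completeNormedModType R[i]}.
Context {dot : {dot H for Num.conj}} (dot_norm : induces_norm dot).
Implicit Types (x y z l : H) (F G U V : {linear H -> H}).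

Lemma linear_function (f : H -> H) : linear f ->
  exists F : {linear H -> H}, forall x, F x = f x.
Proof.
move=> lf.
pose F : {linear H -> H} := HB.pack f (GRing.isLinear.Build R[i] H H _ f lf).
by exists F.
Qed.

Lemma cvg_nrmP (u : nat -> H) l : u @ \oo --> l <->
  forall eps : R, 0 < eps -> exists N, forall n, (N <= n)%N -> nrm (l - u n) < eps.
Proof.
split.
  move/cvgrPdist_lt => h eps eps0.
  have /h [N _ HN] : 0 < eps%:C by rewrite ltcR.
  by exists N => n /HN /=; rewrite nrmE ltcR.
move=> h; apply/cvgrPdist_lt => e e0.
have er : e = (complex.Re e)%:C by rewrite RRe_real // gtr0_real.
have /h [N HN] : 0 < complex.Re e by rewrite -ltcR -er.
by exists N => // n /HN /=; rewrite nrmE er ltcR.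
Qed.

Lemma cauchy_nrm (u : nat -> H) :
  (forall eps : R, 0 < eps ->
     exists N, forall n, (N <= n)%N -> nrm (u N - u n) < eps) ->
  exists l, u @ \oo --> l.
Proof.
move=> h; apply/cvg_ex; apply/cauchy_cvgP; apply: cauchy_exP => e e0.
have er : e = (complex.Re e)%:C by rewrite RRe_real // gtr0_real.
have /h [N HN] : 0 < complex.Re e by rewrite -ltcR -er.
exists (u N); exists N => // n /HN /=.
by rewrite -ball_normE /= nrmE {2}er ltcR.
Qed.

Lemma cvg_bounded (f : H -> H) (M : R) (u : nat -> H) l :
  (forall x y, nrm (f x - f y) <= M * nrm (x - y)) ->
  u @ \oo --> l -> (fun n => f (u n)) @ \oo --> f l.
Proof.
move=> fM /cvg_nrmP ul; apply/cvg_nrmP => eps eps0.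
have M1 : 0 < `|M| + 1 by rewrite ltr_wpDl.
have /ul [N HN] : 0 < eps / (`|M| + 1) by rewrite divr_gt0.
exists N => n /HN; rewrite ltr_pdivlMr // mulrC => h.
apply: le_lt_trans (fM _ _) _; apply: le_lt_trans h.
rewrite ler_wpM2r ?nrm_ge0 //; have := ler_norm M; lra.
Qed.

Lemma cvg_linear F (M : R) (u : nat -> H) l :
  (forall x, nrm (F x) <= M * nrm x) ->
  u @ \oo --> l -> (fun n => F (u n)) @ \oo --> F l.
Proof.
by move=> FM; apply: (@cvg_bounded _ M) => x y; rewrite -linearB.
Qed.

Lemma cvg_dotl (u : nat -> H) l y :
  u @ \oo --> l -> (fun n => dot (u n) y) @ \oo --> dot l y.
Proof.
move=> /cvg_nrmP ul; apply/cvgrPdist_lt => e e0.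
have er : e = (complex.Re e)%:C by rewrite RRe_real // gtr0_real.
have er0 : 0 < complex.Re e by rewrite -ltcR -er.
have M1 : 0 < nrm y + 1 by rewrite ltr_wpDl ?nrm_ge0.
have /ul [N HN] : 0 < complex.Re e / (nrm y + 1) by rewrite divr_gt0.
exists N => // n /HN; rewrite ltr_pdivlMr //= => h.
rewrite -dotBl; apply: le_lt_trans (cauchy_schwarz dot_norm _ _) _.
rewrite er ltcR; apply: le_lt_trans h.
by rewrite ler_wpM2l ?nrm_ge0 // lerDl.
Qed.

Lemma cvg_dotr (u : nat -> H) l y :
  u @ \oo --> l -> (fun n => dot y (u n)) @ \oo --> dot y l.
Proof.
move=> /(@cvg_dotl _ _ y) /cvgrPdist_lt h; apply/cvgrPdist_lt => e /h [N _ HN].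
exists N => // n /HN /=.
by rewrite -dotBl (dotC (l - u n) y) norm_conjC dotBr.
Qed.

Lemma cvg_nrm_le (u : nat -> H) l (c : R) :
  u @ \oo --> l -> (forall n, nrm (u n) <= c) -> nrm l <= c.
Proof.
move=> /cvg_nrmP ul uc; rewrite leNgt; apply/negP => cl.
have /ul [N /(_ N (leqnn N)) h] : 0 < nrm l - c by rewrite subr_gt0.
have := nrmD (l - u N) (u N); rewrite subrK; have := uc N; lra.
Qed.

(** Uniform boundedness passes the bound to the limit; linearity needs only pointwise
convergence. *)
Lemma strong_limit (F : nat -> H -> H) (M : R) :
  (forall n, linear (F n)) -> (forall n x, nrm (F n x) <= M * nrm x) ->
  (forall x, exists l, F ^~ x @ \oo --> l) ->
  exists U : {linear H -> H}, (forall x, F ^~ x @ \oo --> U x) /\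
    (forall x, nrm (U x) <= M * nrm x).
Proof.
move=> linF bF /choice [f Hf].
have [|U HU] := @linear_function f.
  move=> a x y; apply: (cvg_unique _ (Hf _)) => //.
  rewrite (_ : F ^~ _ = (fun n => a *: F n x + F n y)); last first.
    by apply/funext => n; exact: linF.
  by apply: cvgD => //; apply: cvgZr.
exists U; split=> x; rewrite HU //.
by apply: cvg_nrm_le (Hf x) _ => n.
Qed.

(** The inner product is continuous in each argument, so adjointness passes to strong
limits. *)
Lemma strong_limit_adjoint (F G : nat -> H -> H) U V :
  (forall n x y, dot (F n x) y = dot x (G n y)) ->
  (forall x, F ^~ x @ \oo --> U x) -> (forall x, G ^~ x @ \oo --> V x) ->
  is_adjoint dot U V.
Proof.
move=> FG FU GV x y; apply: (cvg_unique _ (@cvg_dotl _ _ y (FU x))) => //.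
rewrite (_ : (fun n => _) = (fun n => dot x (G n y))); last first.
  by apply/funext => n; exact: FG.
exact: cvg_dotr.
Qed.

Lemma nrm_sqr_sum (v : nat -> H) m n :
  (forall j k, j != k -> dot (v j) (v k) = 0) ->
  nrm (\sum_(m <= k < n) v k) ^+ 2 = \sum_(m <= k < n) nrm (v k) ^+ 2.
Proof.
move=> vo; have [nm|mn] := leqP n m; first by rewrite !big_geq // nrm0 expr0n.
rewrite -(subnKC (ltnW mn)); elim: (n - m)%N => [|p IH].
  by rewrite addn0 !big_geq // nrm0 expr0n.
rewrite addnS !big_nat_recr ?leq_addr //= (nrm_sqrD dot_norm) ?IH //.
rewrite dot_suml big_nat big1 // => i /andP[_ ip]; apply: vo.
by rewrite ltn_eqF.
Qed.

(** By Pythagoras the squared norm of a block of the series is a difference of two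
partial sums of a bounded series of nonnegative reals, so the series is Cauchy. *)
Lemma orthogonal_sum (U : nat -> H -> H) (M : R) : 0 <= M ->
  (forall k, linear (U k)) ->
  (forall x j k, j != k -> dot (U j x) (U k x) = 0) ->
  (forall x n, \sum_(0 <= k < n) nrm (U k x) ^+ 2 <= (M * nrm x) ^+ 2) ->
  exists W : {linear H -> H},
    (forall x, (fun n => \sum_(0 <= k < n) U k x) @ \oo --> W x) /\
    (forall x, nrm (W x) <= M * nrm x).
Proof.
move=> M0 Ul Uo Ub; apply: (@strong_limit (fun n x => \sum_(0 <= k < n) U k x)).
- move=> n a x y; rewrite scaler_sumr -big_split; apply: eq_bigr => k _.
  by rewrite Ul.
- move=> n x; rewrite -(@ler_pXn2r _ 2) ?nnegrE ?mulr_ge0 ?nrm_ge0 //.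
  by rewrite nrm_sqr_sum //; exact: Uo.
- move=> x; apply: cauchy_nrm => eps eps0.
  pose s n := \sum_(0 <= k < n) nrm (U k x) ^+ 2.
  have sh : nondecreasing_seq s.
    apply/nondecreasing_seqP => n; rewrite /s big_nat_recr //= lerDl.
    by rewrite exprn_ge0 ?nrm_ge0.
  have sc : cvgn s.
    apply: nondecreasing_is_cvgn => //; exists ((M * nrm x) ^+ 2).
    by move=> _ [n _ <-]; exact: Ub.
  have /cvgrPdist_lt /(_ (eps ^+ 2)) [|N _ HN] := sc; first by rewrite exprn_gt0.
  exists N => n Nn.
  rewrite -(@ltr_pXn2r _ 2) ?nnegrE ?nrm_ge0 // ?(ltW eps0) //.
  rewrite (big_cat_nat (leq0n N) Nn) /=.
  rewrite opprD addNKr nrmN nrm_sqr_sum; last exact: Uo.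
  have := nondecreasing_cvgn_le sh sc n.
  rewrite {1}/s (big_cat_nat (leq0n N) Nn) /=.
  have := HN N (leqnn N) => /= /ltr_normlP [_]; rewrite -/(s N); lra.
Qed.

End strong_limits.

(** * Operators given on orthogonal families *)

Section orthogonal_families.
Context {R : realType} {H : completeNormedModType R[i]}.
Context {dot : {dot H for Num.conj}} (dot_norm : induces_norm dot).
Implicit Types (x y z l : H) (D E F G J U V : {linear H -> H}).

Lemma nrm_sqrB x y (r : R) : dot x y = r%:C ->
  nrm (x - y) ^+ 2 = nrm x ^+ 2 - r *+ 2 + nrm y ^+ 2.
Proof.
move=> xy; apply: complexI.
have yx : dot y x = r%:C by rewrite dotC xy; apply: conj_Creal; rewrite complex_real.
rewrite !rmorphD rmorphN /= rmorphMn /= -!(dotxx dot_norm) dotBl !dotBr xy yx.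
by ring.
Qed.

Lemma nrm_unit x : dot x x = 1 -> nrm x = 1.
Proof.
by rewrite (dotxx dot_norm) => /complexI/eqP; rewrite sqrp_eq1 ?nrm_ge0 // => /eqP.
Qed.

(** Expand [0 <= nrm (x - \sum_k z k) ^+ 2].  The vectors [z k] are meant to be images
of [x] under mutually orthogonal contractions: rank-one ones for the usual Bessel
inequality, blocks in [block_operator]. *)
Lemma bessel x (z : nat -> H) (a : nat -> R) n :
  (forall j k, j != k -> dot (z j) (z k) = 0) ->
  (forall k, dot x (z k) = (a k ^+ 2)%:C) -> (forall k, nrm (z k) <= a k) ->
  \sum_(0 <= k < n) a k ^+ 2 <= nrm x ^+ 2.
Proof.
move=> zo xz za.
have /(nrm_sqrB) : dot x (\sum_(0 <= k < n) z k) = (\sum_(0 <= k < n) a k ^+ 2)%:C.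
  by rewrite dot_sumr rmorph_sum /=; apply: eq_bigr => k _; exact: xz.
rewrite (nrm_sqr_sum dot_norm) // => e.
have : \sum_(0 <= k < n) nrm (z k) ^+ 2 <= \sum_(0 <= k < n) a k ^+ 2.
  apply: ler_sum => k _; apply: lerXn2r; rewrite ?nnegrE ?nrm_ge0 //.
  exact: le_trans (nrm_ge0 _) (za k).
have := sqr_ge0 (nrm (x - \sum_(0 <= k < n) z k)); rewrite e; lra.
Qed.

(** Allowing norms below 1 admits families extended by zero vectors and families of
weighted basis vectors, with the same Bessel inequality. *)
Definition suborthonormal {T : eqType} (g : T -> H) :=
  (forall s t, s != t -> dot (g s) (g t) = 0) /\ (forall t, nrm (g t) <= 1).

Definition orthonormal_family {T : eqType} (g : T -> H) :=
  forall s t, dot (g s) (g t) = (s == t)%:R.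

Definition total_family {T : Type} (g : T -> H) :=
  forall x, (forall t, dot x (g t) = 0) -> x = 0.

Lemma orthonormal_unit {T : eqType} (g : T -> H) t :
  orthonormal_family g -> dot (g t) (g t) = 1.
Proof. by move=> go; rewrite go eqxx. Qed.

Lemma orthonormal_sub {T : eqType} {g : T -> H} :
  orthonormal_family g -> suborthonormal g.
Proof.
move=> go; split=> [s t /negPf st|t]; first by rewrite go st.
by rewrite nrm_unit // go eqxx.
Qed.

Let rank1 (u v : nat -> H) k x := dot x (u k) *: v k.

Let transfer_nat (u v : nat -> H) : suborthonormal u -> suborthonormal v ->
  exists U, (forall x, (fun n => \sum_(0 <= k < n) rank1 u v k x) @ \oo --> U x) /\
   (forall x, nrm (U x) <= nrm x).
Proof.
move=> [uo u1] [vo v1].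
have [//|k a x y|x j k jk|x n|U [HU bU]] := @orthogonal_sum R H dot dot_norm (rank1 u v) 1.
- by rewrite /rank1 dotDl dotZl scalerDl scalerA.
- by rewrite /rank1 dotZl dotZr vo // !mulr0.
- rewrite mul1r.
  apply: le_trans _ (@bessel x (rank1 u u ^~ x)
    (fun k => complex.Re `|dot x (u k)|) n _ _ _).
  + apply: ler_sum => k _; apply: lerXn2r; rewrite ?nnegrE ?nrm_ge0 //.
      by rewrite -ler0c RRe_real ?normr_real.
    by rewrite nrmcZ ler_piMr // -ler0c RRe_real ?normr_real.
  + by move=> j k jk; rewrite /rank1 dotZl dotZr uo // !mulr0.
  + by move=> k; rewrite /rank1 dotZr -normCKC -[in LHS](RRe_real (normr_real _)) rmorphXn.
  + by move=> k; rewrite nrmcZ ler_piMr // -ler0c RRe_real ?normr_real.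
- by exists U; split=> // x; have := bU x; rewrite mul1r.
Qed.

Let transfer_nat_adjoint u v U V :
  (forall x, (fun n => \sum_(0 <= k < n) rank1 u v k x) @ \oo --> U x) ->
  (forall x, (fun n => \sum_(0 <= k < n) rank1 v u k x) @ \oo --> V x) ->
  is_adjoint dot U V.
Proof.
apply: (@strong_limit_adjoint R H dot dot_norm (fun n x => \sum_(0 <= k < n) rank1 u v k x)
  (fun n x => \sum_(0 <= k < n) rank1 v u k x)) => n x y.
rewrite dot_suml dot_sumr; apply: eq_bigr => k _.
by rewrite /rank1 dotZl dotZr -dotC mulrC.
Qed.

(** The operators are [x |-> \sum_t <x, g t> h t] and the same with [g] and [h]
exchanged.  Their values on the two families and on the orthogonal complements
determine them. *)
Lemma transfer {T : countType} {g h : T -> H} :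
  suborthonormal g -> suborthonormal h ->
  exists U V, [/\ is_adjoint dot U V, (forall x, nrm (U x) <= nrm x),
    (forall t, U (g t) = dot (g t) (g t) *: h t),
    (forall t, V (h t) = dot (h t) (h t) *: g t) &
    (forall x, (forall t, dot x (g t) = 0) -> U x = 0) /\
    (forall x, (forall t, dot x (h t) = 0) -> V x = 0)].
Proof.
(* Families over [T] become sequences, zero outside the range of [pickle]. *)
pose ext (f : T -> H) n := oapp f 0 (pickle_inv n).
have exto f : suborthonormal f -> suborthonormal (ext f).
  move=> [fo f1]; split=> [m n mn|n]; rewrite /ext; last first.
    by case: pickle_inv => //=; rewrite nrm0.
  have := @pickle_invK T m; have := @pickle_invK T n.
  case: (pickle_inv m) => [s|]; case: (pickle_inv n) => [t|] //=;
    rewrite ?dot0l ?dot0r //.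
  by move=> tn sm; apply: fo; apply: contra_neq mn => st; rewrite -tn -sm st.
have ext_eq f t n : suborthonormal f ->
    dot (f t) (ext f n) = if n == pickle t then dot (f t) (f t) else 0.
  move=> [fo _]; rewrite /ext; case: eqP => [->|nt]; first by rewrite pickleK_inv.
  have := @pickle_invK T n; case: (pickle_inv n) => [s /= sn|]; last by rewrite dot0r.
  by rewrite fo //; apply: contra_not_neq nt => ->.
have onfam (f f' : T -> H) (W : {linear H -> H}) : suborthonormal f ->
    (forall x, (fun n => \sum_(0 <= k < n) rank1 (ext f) (ext f') k x) @ \oo --> W x) ->
    forall t, W (f t) = dot (f t) (f t) *: f' t.
  move=> fo HW t; apply: (cvg_unique _ (HW (f t))) => //.
  apply/cvg_nrmP => eps eps0; exists (pickle t).+1 => n tn.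
  rewrite (bigD1_seq (pickle t)) ?mem_index_iota ?iota_uniq //=.
  rewrite {1}/rank1 ext_eq // eqxx {1}/ext pickleK_inv /= big1 ?addr0 ?subrr ?nrm0 //.
  by move=> k /negPf kt; rewrite /rank1 ext_eq // kt scale0r.
have orth0 (f f' : T -> H) (W : {linear H -> H}) :
    (forall x, (fun n => \sum_(0 <= k < n) rank1 (ext f) (ext f') k x) @ \oo --> W x) ->
    forall x, (forall t, dot x (f t) = 0) -> W x = 0.
  move=> HW x xf; apply: (cvg_unique _ (HW x)) => //.
  rewrite (_ : (fun n => _) = (fun=> 0)); first exact: cvg_cst.
  apply/funext => n; rewrite big1 // => k _; rewrite /rank1 /ext.
  by case: pickle_inv => [t|] /=; rewrite ?xf ?dot0r scale0r.
move=> go ho.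
have [U [HU bU]] := transfer_nat _ _ (exto _ go) (exto _ ho).
have [V [HV bV]] := transfer_nat _ _ (exto _ ho) (exto _ go).
exists U, V; split => //.
- exact: transfer_nat_adjoint HU HV.
- exact: onfam HU.
- exact: onfam HV.
- by split; [exact: orth0 HU | exact: orth0 HV].
Qed.

(** The adjoints of two operators that agree on a total family agree, because their
difference is orthogonal to that family; hence so do the operators.  This replaces
continuity and density of a span. *)
Lemma eq_total {T : Type} {g : T -> H} {f f' fs fs' : H -> H} :
  total_family g -> (forall x y, dot (f x) y = dot x (fs y)) ->
  (forall x y, dot (f' x) y = dot x (fs' y)) ->
  (forall t, f (g t) = f' (g t)) -> forall x, f x = f' x.
Proof.
move=> gt ff ff' e x.
have es y : fs y = fs' y.
  apply/eqP; rewrite -subr_eq0; apply/eqP; apply: gt => t.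
  by apply: dot_eq0C; rewrite dotBr -ff -ff' e subrr.
apply/eqP; rewrite -subr_eq0; apply/eqP; apply: (@dotr0_eq0 _ _ dot) => y.
by rewrite dotBl ff ff' es subrr.
Qed.

(** For [E] the operator that [transfer] attaches to [e] and [e], and [V] its adjoint,
[x - E x] is orthogonal to [e], hence killed by both [E] and [V]; this gives
[E E = E] and [V E = V], so [<E x, y> = <E x, E y>] is hermitian in [x] and [y]. *)
Lemma span_projection {T : countType} (e : T -> H) : orthonormal_family e ->
  exists E, [/\ self_adjoint dot E, (forall x, nrm (E x) <= nrm x),
    (forall x, E (E x) = E x), (forall t, E (e t) = e t) &
    (forall x, (forall t, dot x (e t) = 0) -> E x = 0)].
Proof.
move=> eo; have so := orthonormal_sub eo.
have [E [V [EV bE Ee Ve [E0 V0]]]] := transfer so so.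
have Eet t : E (e t) = e t by rewrite Ee orthonormal_unit // scale1r.
have res0 x t : dot (x - E x) (e t) = 0.
  by rewrite dotBl EV Ve orthonormal_unit // scale1r subrr.
have EE x : E (E x) = E x.
  by apply/esym/eqP; rewrite -subr_eq0 -linearB (E0 _ (res0 x)).
have VE x : V (E x) = V x.
  by apply/esym/eqP; rewrite -subr_eq0 -linearB (V0 _ (res0 x)).
have dE x y : dot (E x) y = dot (E x) (E y) by rewrite EV -VE -EV.
by exists E; split=> // x y; rewrite dE [RHS]dotC (dE y x) -dotC.
Qed.

Lemma self_adjoint_total {T : Type} {g : T -> H} {U V} :
  total_family g -> is_adjoint dot U V ->
  (forall s t, dot (U (g s)) (g t) = dot (g s) (U (g t))) -> self_adjoint dot U.
Proof.
move=> gt UV Ug.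
have VU x y : dot (V x) y = dot x (U y) by rewrite dotC -UV -dotC.
suff e x : U x = V x by move=> x y; rewrite UV e.
move: x; apply: (eq_total gt UV VU) => t.
apply/eqP; rewrite -subr_eq0; apply/eqP; apply: gt => s.
by rewrite dotBl VU -Ug subrr.
Qed.

Lemma permutation_symmetry {T : countType} (g : T -> H) (tau : T -> T) :
  orthonormal_family g -> total_family g -> involutive tau ->
  exists J, [/\ (forall x, nrm (J x) <= nrm x), self_adjoint dot J,
    (forall x, J (J x) = x) & forall t, J (g t) = g (tau t)].
Proof.
move=> go gt tauK.
have ho : suborthonormal (g \o tau).
  have [os ns] := orthonormal_sub go; split=> [s t st|t]; last exact: ns.
  by apply: os; rewrite (can_eq tauK).
have [J [V [JV bJ Jg _ _]]] := transfer (orthonormal_sub go) ho.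
have Jgt t : J (g t) = g (tau t) by rewrite Jg orthonormal_unit // scale1r.
have sJ : self_adjoint dot J.
  apply: self_adjoint_total gt JV _ => s t; rewrite !Jgt !go.
  by rewrite -(inj_eq (can_inj tauK)) tauK.
exists J; split=> //.
apply: (@eq_total _ g (J \o J) id (J \o J) id gt) => // x.
- by move=> y /=; rewrite !sJ.
- by rewrite /= !Jgt tauK.
Qed.

Lemma diagonal_operator {T : countType} (g : T -> H) (d : T -> R) :
  orthonormal_family g -> total_family g -> (forall t, `|d t| <= 1) ->
  exists D, [/\ (forall x, nrm (D x) <= nrm x), self_adjoint dot D
    & forall t, D (g t) = (d t)%:C *: g t].
Proof.
move=> go gt d1.
have ho : suborthonormal (fun t => (d t)%:C *: g t).
  have [os ns] := orthonormal_sub go; split=> [s t st|t].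
    by rewrite dotZl dotZr os // !mulr0.
  by rewrite nrmZ mulr_ile1 ?nrm_ge0.
have [D [V [DV bD Dg _ _]]] := transfer (orthonormal_sub go) ho.
have Dgt t : D (g t) = (d t)%:C *: g t by rewrite Dg orthonormal_unit // scale1r.
exists D; split=> //.
apply: self_adjoint_total gt DV _ => s t; rewrite !Dgt dotZl dotZr go.
have -> : ((d t)%:C^*)%R = (d t)%:C :> R[i] by apply: conj_Creal; rewrite complex_real.
by case: eqP => [->|_]; rewrite ?mulr0.
Qed.

End orthogonal_families.

(** * Orthonormalisation and dimension *)

Section dimension.
Context {R : realType} {H : completeNormedModType R[i]}.
Context {dot : {dot H for Num.conj}} (dot_norm : induces_norm dot).
Implicit Types (x y z l : H) (D F G J U V : {linear H -> H}).

Let unit_of x := (nrm x)^-1%:C *: x.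

Let unit_of_dot x : unit_of x = 0 \/ dot (unit_of x) (unit_of x) = 1.
Proof.
have [->|x0] := eqVneq x 0; [left|right]; first by rewrite /unit_of scaler0.
have n0 : nrm x != 0 by apply: contra_neq x0 => /nrm_eq0.
by rewrite (dotxx dot_norm) nrmZ ger0_norm ?invr_ge0 ?nrm_ge0 // mulVf // expr1n.
Qed.

Let unit_ofK x : x = (nrm x)%:C *: unit_of x.
Proof.
have [->|x0] := eqVneq x 0; first by rewrite /unit_of !scaler0.
have n0 : nrm x != 0 by apply: contra_neq x0 => /nrm_eq0.
by rewrite /unit_of scalerA -rmorphM mulfV // rmorph1 scale1r.
Qed.

Let residue (s : seq H) x := x - \sum_(f <- s) dot x f *: f.

(** Zero residues are kept as zero vectors, so that the recursion makes no choice.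
The last two clauses say that [f] and [u] have the same orthogonal complement, in
the form that is used. *)
Lemma gram_schmidt (u : nat -> H) : exists f : nat -> H,
  [/\ (forall m n, m != n -> dot (f m) (f n) = 0),
      (forall n, f n = 0 \/ dot (f n) (f n) = 1),
      (forall x n, (forall k, (k <= n)%N -> dot x (f k) = 0) -> dot x (u n) = 0) &
      (forall x n, (forall k, (k <= n)%N -> dot x (u k) = 0) -> dot x (f n) = 0)].
Proof.
pose prev := fix prev n := if n is m.+1 then
  rcons (prev m) (unit_of (residue (prev m) (u m))) else [::].
pose f n := unit_of (residue (prev n) (u n)).
have prevE n y : residue (prev n) y = y - \sum_(0 <= k < n) dot y (f k) *: f k.
  congr (_ - _); elim: n => [|n IH]; first by rewrite big_nil big_geq.
  by rewrite /= big_rcons /= big_nat_recr //= IH.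
have fu n : f n = 0 \/ dot (f n) (f n) = 1 by exact: unit_of_dot.
have fo n : forall m, (m < n)%N -> dot (f n) (f m) = 0.
  have [p] := ubnP n; elim: p n => // p IH n np m mn.
  have o j k : (j < n)%N -> (k < n)%N -> j != k -> dot (f j) (f k) = 0.
    rewrite neq_ltn => jn kn /orP[jk|kj].
      by apply: dot_eq0C; apply: IH jk; lia.
    by apply: IH kj; lia.
  rewrite {1}/f /unit_of dotZl; move: ((nrm _)^-1%:C) => a; rewrite prevE dotBl dot_suml.
  rewrite (bigD1_seq m) ?mem_index_iota ?iota_uniq //= big_nat_cond big1 ?addr0.
    rewrite dotZl; case: (fu m) => [->|->]; first by rewrite !dot0r mulr0 subrr mulr0.
    by rewrite mulr1 subrr mulr0.
  by move=> k /andP[/andP[_ kn] km]; rewrite dotZl o // mulr0.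
exists f; split=> //.
- move=> m n; rewrite neq_ltn => /orP[mn|nm]; last exact: fo.
  by apply: dot_eq0C; apply: fo.
- move=> x n xf.
  rewrite -[u n](subrK (\sum_(0 <= k < n) dot (u n) (f k) *: f k)) -prevE dotDr.
  rewrite (unit_ofK (residue _ _)) -/(f n) dotZr xf // mulr0 add0r dot_sumr.
  by rewrite big_nat big1 // => k /andP[_ kn]; rewrite dotZr xf ?mulr0 // ltnW.
- move=> x; elim/ltn_ind => n IH xu.
  rewrite {1}/f dotZr; move: (_^*%R) => a; rewrite prevE dotBr xu //.
  rewrite dot_sumr big_nat big1 ?subr0 ?mulr0 //.
  move=> k /andP[_ kn]; rewrite dotZr IH ?mulr0 // => j jk; apply: xu.
  exact: leq_trans jk (ltnW kn).
Qed.

Lemma exists_unit_orthogonal (s : seq H) : infinite_dimensional [set: H] ->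
  exists x, dot x x = 1 /\ (forall y, y \in s -> dot x y = 0).
Proof.
move=> Hinf; have [f [fo fu fs _]] := gram_schmidt (nth 0 s).
have [/= x x0] : exists x, x - \sum_(k < size s) dot x (f k) *: f k != 0.
  apply: contrapT => /forallNP h; apply: Hinf.
  exists (size s), f; split=> // x _; exists (fun k => dot x (f k)).
  by apply/eqP; rewrite -subr_eq0; apply/negPn/negP/h.
set z := _ - _ in x0.
have zf k : (k < size s)%N -> dot z (f k) = 0.
  move=> ks; rewrite dotBl dot_suml (bigD1 (Ordinal ks)) //= big1 ?addr0.
    by rewrite dotZl; case: (fu k) => ->; rewrite ?dot0r ?mulr1 ?mulr0 subrr.
  by move=> j jk; rewrite dotZl fo ?mulr0.
exists (unit_of z); split.
  case: (unit_of_dot z) => // z0; move: x0.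
  by rewrite (unit_ofK z) z0 scaler0 eqxx.
move=> y ys; rewrite dotZl -(nth_index 0 ys) fs ?mulr0 // => k ks.
by apply: zf; apply: leq_ltn_trans ks _; rewrite index_mem.
Qed.

(** If [n] vectors spanned the range, the images of [v 0, ..., v n] would be linearly
dependent; by injectivity on the eigenspace, so would be [v 0, ..., v n]. *)
Lemma infinite_range (F : H -> H) J (c : R[i]) (v : nat -> H) :
  linear F -> orthonormal_family (dot := dot) v -> (forall k, J (v k) = c *: v k) ->
  (forall x, J x = c *: x -> F x = 0 -> x = 0) ->
  infinite_dimensional (range F).
Proof.
move=> /linear_function [G GF] vo Jv inj [n [e [_ span]]].
have /choice [a Ha] : forall k : 'I_n.+1, exists b : 'I_n -> R[i],
    F (v k) = \sum_(i < n) b i *: e i by move=> k; apply: span; exists (v k).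
pose M := \matrix_(k < n.+1, i < n) a k i.
(* [M] has more rows than columns, so some nonzero [w] satisfies [w *m M = 0]. *)
have : kermx M != 0.
  by rewrite -mxrank_eq0 mxrank_ker -lt0n subn_gt0 ltnS rank_leq_col.
case/rowV0Pn => w /sub_kermxP wM w0.
pose x := \sum_(k < n.+1) w 0 k *: v k.
have x0 : x = 0.
  apply: inj.
    rewrite linear_sum scaler_sumr; apply: eq_bigr => k _.
    by rewrite linearZ /= Jv !scalerA mulrC.
  rewrite -GF linear_sum.
  transitivity (\sum_(i < n) (w *m M) 0 i *: e i); last first.
    by rewrite wM big1 // => i _; rewrite mxE scale0r.
  under eq_bigr => k _ do rewrite linearZ /= GF Ha scaler_sumr.
  rewrite exchange_big; apply: eq_bigr => i _; rewrite mxE scaler_suml.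
  by apply: eq_bigr => k _; rewrite mxE scalerA.
case/negP: w0; apply/eqP/rowP => k; rewrite mxE.
have : dot x (v k) = 0 by rewrite x0 dot0l.
rewrite dot_suml (bigD1 k) //= big1 ?addr0; first by rewrite dotZl vo eqxx mulr1.
by move=> j jk; rewrite dotZl vo (negPf (_ : (j : nat) != k)) ?mulr0.
Qed.

End dimension.

(** * Projections from operators that anticommute with a symmetry *)

Section projection_pairs.
Context {R : realType} {H : completeNormedModType R[i]}.
Context {dot : {dot H for Num.conj}} (dot_norm : induces_norm dot).
Implicit Types (x y z l : H) (B F J P Q S T V Z : {linear H -> H}).

Lemma exists_small_geometric (c eps : R) : 0 <= c -> 0 < eps ->
  exists N : nat, c * 2^-1 ^+ N < eps.
Proof.
move=> c0 eps0; exists (Num.bound (c / eps)).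
have : c / eps < 2 ^+ Num.bound (c / eps).
  apply: lt_le_trans (archi_boundP _) _; first by rewrite divr_ge0 // ltW.
  by rewrite -natrX ler_nat ltnW // ltn_expl.
rewrite ltr_pdivrMr // => h; rewrite exprVn ltr_pdivrMr ?exprn_gt0 //.
by rewrite mulrC.
Qed.

(** [1 - V] is the square root of [1 - T].  On the operators of norm at most 1/2, the
map [F |-> (T + F^2) / 2] is a contraction of ratio 1/2; its iterates from 0 are
polynomials in [T], whence the commutation property.  Knowing that [V] has norm at
most 1/2 gives the positivity of [1 - V] needed for [proper_projection]. *)
Lemma sqrt_operator T : self_adjoint dot T ->
  (forall x, nrm (T x) <= 4^-1 * nrm x) ->
  exists V, [/\ self_adjoint dot V, (forall x, nrm (V x) <= 2^-1 * nrm x),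
    (forall x, V x + V x = T x + V (V x)) &
    (forall Z, bounded_operator Z -> (forall x, Z (T x) = T (Z x)) ->
       forall x, Z (V x) = V (Z x))].
Proof.
move=> sT bT.
pose f := fix f n x : H := if n is m.+1 then 2^-1%:C *: (T x + f m (f m x)) else 0.
have fS n x : f n.+1 x = 2^-1%:C *: (T x + f n (f n x)) by [].
have lf n : linear (f n).
  elim: n => [|n IH] a x y; first by rewrite /= scaler0 addr0.
  by rewrite !fS linearP !IH !scalerDr !scalerA (mulrC a) addrACA.
have lfB n x y : f n (x - y) = f n x - f n y.
  by have [F HF] := linear_function _ (lf n); rewrite -!HF linearB.
have bf n x : nrm (f n x) <= 2^-1 * nrm x.
  elim: n x => [|n IH] x; first by rewrite nrm0 mulr_ge0 ?nrm_ge0 // invr_ge0.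
  rewrite fS nrmZ ger0_norm ?invr_ge0 //.
  have := nrmD (T x) (f n (f n x)); have := IH (f n x); have := IH x; have := bT x.
  have := nrm_ge0 x; lra.
have sf n x y : dot (f n x) y = dot x (f n y).
  elim: n x y => [|n IH] x y; first by rewrite dot0l dot0r.
  rewrite !fS dotZl dotZr dotDl dotDr sT !IH; congr (_ * _).
  by apply/esym/conj_Creal; rewrite complex_real.
have step n x : nrm (f n.+1 x - f n x) <= 2^-1 ^+ n * nrm x.
  elim: n x => [|n IH] x.
    by rewrite subr0; apply: le_trans (bf _ _) _; rewrite ler_wpM2r ?nrm_ge0 //; lra.
  have -> : f n.+2 x - f n.+1 x = 2^-1%:C *:
      (f n.+1 (f n.+1 x - f n x) + (f n.+1 (f n x) - f n (f n x))).
    rewrite (fS n.+1) [X in _ - X]fS -scalerBr lfB subrKA.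
    by rewrite opprD addrACA subrr add0r.
  rewrite nrmZ ger0_norm ?invr_ge0 //.
  have := nrmD (f n.+1 (f n.+1 x - f n x)) (f n.+1 (f n x) - f n (f n x)).
  have := IH x; have := IH (f n x); have := bf n.+1 (f n.+1 x - f n x).
  have := bf n x; rewrite exprS; have := nrm_ge0 x.
  have : 0 <= (2^-1 : R) ^+ n by rewrite exprn_ge0 ?invr_ge0.
  move: (nrm _) (nrm _) (nrm _) (nrm _) => a b c d; nra.
have cauchy x N d : nrm (f N x - f (N + d)%N x) <=
    (2 * nrm x) * (2^-1 ^+ N - 2^-1 ^+ (N + d)).
  elim: d => [|d IH]; first by rewrite addn0 !subrr nrm0 mulr0.
  rewrite addnS -(subrKA (f (N + d)%N x)).
  have := nrmD (f N x - f (N + d)%N x) (f (N + d)%N x - f (N + d).+1 x).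
  rewrite -[X in nrm X + nrm _]opprB -(opprB (f (N + d).+1 x)) !nrmN.
  have := step (N + d)%N x; rewrite exprS; move: IH.
  rewrite -[X in nrm X <= _]opprB nrmN; nra.
have [|V [VL bV]] := strong_limit f _ lf bf.
  move=> x; apply: cauchy_nrm => eps eps0.
  have [N HN] := exists_small_geometric (2 * nrm x) _ (mulr_ge0 (ler0n _ 2) (nrm_ge0 x)) eps0.
  exists N => n Nn; apply: le_lt_trans HN; rewrite -(subnKC Nn).
  apply: le_trans (cauchy _ _ _) _; rewrite ler_wpM2l ?mulr_ge0 ?nrm_ge0 //.
  by rewrite lerBlDr lerDl exprn_ge0 ?invr_ge0.
exists V; split=> //.
- exact: (strong_limit_adjoint dot_norm f f _ _ sf VL VL).
- move=> x; have ffV : (fun n => f n (f n x)) @ \oo --> V (V x).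
    apply/cvg_nrmP => eps eps0.
    have e2 : 0 < eps / 2 by rewrite divr_gt0.
    have /cvg_nrmP/(_ _ e2) [N1 H1] := VL x.
    have /cvg_nrmP/(_ _ e2) [N2 H2] := VL (V x).
    exists (maxn N1 N2) => n; rewrite geq_max => /andP[/H1 h1 /H2 h2].
    rewrite -(subrKA (f n (V x))) -lfB.
    have := nrmD (V (V x) - f n (V x)) (f n (V x - f n x)).
    have := bf n (V x - f n x); have := nrm_ge0 (V x - f n x).
    lra.
  have h1 : (fun n => f n.+1 x) @ \oo --> V x by rewrite (cvg_shiftS (f ^~ x)); exact: VL.
  have h2 : (fun n => f n.+1 x) @ \oo --> 2^-1%:C *: (T x + V (V x)).
    by apply: cvgZr; apply: cvgD => //; exact: cvg_cst.
  have e : V x = 2^-1%:C *: (T x + V (V x)) by apply: cvg_unique h1 h2.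
  have {1 2}-> := e; rewrite -scalerDl -rmorphD (_ : 2^-1 + 2^-1 = 1 :> R); last by lra.
  by rewrite rmorph1 scale1r.
- move=> Z /bounded_nrmP [M bZ] ZT x.
  have h1 := cvg_linear _ _ _ _ bZ (VL x).
  apply: (cvg_unique _ h1) => //.
  rewrite (_ : (fun n => _) = f ^~ (Z x)); first exact: VL.
  apply/funext => n; elim: n x {h1} => [|n IH] x; first by rewrite linear0.
  by rewrite !fS linearZ linearD ZT !IH.
Qed.

Lemma conj_real (c : R) : ((c%:C)^*)%R = c%:C :> R[i].
Proof. by apply: conj_Creal; rewrite complex_real. Qed.

Lemma halfD x : 2^-1%:C *: x + 2^-1%:C *: x = x.
Proof.
rewrite -scalerDl -rmorphD (_ : 2^-1 + 2^-1 = 1 :> R); last by lra.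
by rewrite rmorph1 scale1r.
Qed.

Lemma symmetry_isometry J x : self_adjoint dot J -> (forall x, J (J x) = x) ->
  nrm (J x) = nrm x.
Proof.
move=> sJ JJ; apply/eqP; rewrite -(@eqrXn2 _ 2) ?nrm_ge0 //.
by rewrite !(nrm_sqrE dot_norm) sJ JJ.
Qed.

(** With [u = B + J S] one has [u^2 = 1] and [P = (1 + u) / 2].  If [J x = x] then
[<B x, x> = 0] by anticommutation, so [<u x, x> = <S x, x> >= 0], which excludes
[u x = - x], that is [P x = 0], unless [x = 0].  The eigenspace of [J] at [-1]
serves [1 - P] in the same way. *)
Lemma proper_projection B J S P (v w : nat -> H) :
  self_adjoint dot B -> self_adjoint dot J -> self_adjoint dot S ->
  bounded_operator B -> bounded_operator S ->
  (forall x, J (J x) = x) -> (forall x, J (B x) = - B (J x)) ->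
  (forall x, S (S x) = x - B (B x)) -> (forall x, J (S x) = S (J x)) ->
  (forall x, B (S x) = S (B x)) -> (forall x, 0 <= complex.Re (dot (S x) x)) ->
  orthonormal_family (dot := dot) v -> (forall k, J (v k) = v k) ->
  orthonormal_family (dot := dot) w -> (forall k, J (w k) = - w k) ->
  (forall x, P x = 2^-1%:C *: (x + B x + J (S x))) ->
  proper_orthoprojection dot P.
Proof.
move=> sB sJ sS /bounded_nrmP [b bB] /bounded_nrmP [s bS] JJ JB SS JS BS S0.
move=> vo Jv wo Jw Px.
have [|u ux] := @linear_function _ _ (fun x => B x + J (S x)).
  by move=> a x y; rewrite !linearP scalerDr addrACA.
have {}Px x : P x = 2^-1%:C *: (x + u x) by rewrite Px ux addrA.
have uu x : u (u x) = x.
  rewrite [u x]ux linearD !ux.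
  have -> : B (J (S x)) = - J (S (B x)) by rewrite -BS JB opprK.
  rewrite -!JS JJ SS; apply: (@dot_ext _ _ dot) => y.
  by rewrite !dot_lin; ring.
have su : self_adjoint dot u by move=> x y; rewrite !ux dotDl dotDr sB sJ sS JS.
have key (c : R) x : c != 0 -> J x = c%:C *: x -> u x = - (c%:C *: x) -> x = 0.
  move=> c0 Jx ux'.
  have c0' : c%:C != 0 :> R[i] by rewrite fmorph_eq0.
  have Bxx : dot (B x) x = 0.
    have h : dot (B x) (J x) = - dot (B x) (J x).
      by rewrite -{1}sJ JB Jx linearZ /= dotNl dotZl dotZr conj_real.
    move: h; rewrite Jx dotZr conj_real => /eqP; rewrite -addr_eq0 -mulr2n.
    by rewrite mulrn_eq0 /= mulf_eq0 (negPf c0') => /eqP.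
  have : dot (u x) x = c%:C * dot (S x) x.
    by rewrite ux dotDl Bxx add0r sJ Jx dotZr conj_real.
  rewrite ux' dotNl dotZl -mulrN => /(mulfI c0') h.
  apply: nrm_eq0; apply/eqP; rewrite -sqrf_eq0 eq_le sqr_ge0 andbT.
  have := S0 x; rewrite -h (dotxx dot_norm) -rmorphN /=; lra.
have xP x : P x = 0 -> u x = - x.
  rewrite Px => /eqP; rewrite scaler_eq0 fmorph_eq0 invr_eq0 pnatr_eq0 /=.
  by rewrite addrC addr_eq0 => /eqP.
have xIP x : x - P x = 0 -> u x = x.
  move=> h; have Pxx : P x = x by apply/esym/eqP; rewrite -subr_eq0 h.
  by apply: (addrI x); rewrite -[LHS]halfD -!Px Pxx.
split.
- split.
  + apply/bounded_nrmP; exists (1 + `|b| + `|s|) => x; rewrite Px nrmZ ux.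
    rewrite ger0_norm ?invr_ge0 //.
    have := nrmD x (B x + J (S x)); have := nrmD (B x) (J (S x)).
    rewrite (symmetry_isometry _ _ sJ JJ).
    have := bB x; have := bS x; have := ler_norm b; have := ler_norm s.
    have := nrm_ge0 x; have := normr_ge0 b; have := normr_ge0 s.
    move: (nrm (x + _)) (nrm (B x + _)) (nrm (B x)) (nrm (S x)) => *; nra.
  + move=> x y; rewrite !Px dotZl dotZr conj_real dotDl dotDr su.
    by [].
  + move=> x; rewrite Px [X in _ + X](_ : _ = P x) ?scalerDr ?halfD //.
    by rewrite Px linearZ linearD uu /= addrC.
- apply: (infinite_range (dot := dot) P J 1 v) => //.
  + exact: linearP.
  + by move=> k; rewrite scale1r.
  + move=> x; rewrite scale1r => Jx /xP ux'; apply: (key 1) => //.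
      by rewrite rmorph1 scale1r.
    by rewrite rmorph1 scale1r.
- apply: (infinite_range (dot := dot) (fun x => x - P x) J (-1) w) => //.
  + by move=> a x y; rewrite linearP scalerBr opprD addrACA.
  + by move=> k; rewrite scaleN1r.
  + move=> x Jx /xIP ux'; apply: (key (-1)).
    * by rewrite oppr_eq0 oner_eq0.
    * by rewrite rmorphN1.
    * by rewrite rmorphN1 scaleN1r opprK.
Qed.

(** [Q] is obtained from [proper_projection] for [- J], whose eigenspaces are those of
[J] exchanged.  The commutation property of [S] is what later turns eigenvectors of
[B^2] into eigenvectors of [S]. *)
Lemma projection_pair B J (v w : nat -> H) :
  self_adjoint dot B -> (forall x, nrm (B x) <= 2^-1 * nrm x) ->
  self_adjoint dot J -> (forall x, J (J x) = x) ->
  (forall x, J (B x) = - B (J x)) ->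
  orthonormal_family (dot := dot) v -> (forall k, J (v k) = v k) ->
  orthonormal_family (dot := dot) w -> (forall k, J (w k) = - w k) ->
  exists P Q S, [/\ proper_orthoprojection dot P, proper_orthoprojection dot Q,
    (forall x, P x + Q x = x + B x),
    (forall x, P x + P x = x + B x + J (S x)) &
    (forall Z, bounded_operator Z -> (forall x, Z (B (B x)) = B (B (Z x))) ->
       forall x, Z (S x) = S (Z x))].
Proof.
move=> sB bB sJ JJ JB vo Jv wo Jw.
have [|T TE] := @linear_function _ _ (fun x => B (B x)).
  by move=> a x y; rewrite !linearP.
have [||V [sV bV VV Vcomm]] := sqrt_operator T.
- by move=> x y; rewrite !TE !sB.
- by move=> x; rewrite TE; have := bB x; have := bB (B x); lra.
have [|S SE] := @linear_function _ _ (fun x => x - V x).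
  by move=> a x y; rewrite linearP scalerBr opprD addrACA.
have bS x : nrm (S x) <= 2 * nrm x.
  by rewrite SE; have := nrmB x (V x); have := bV x; have := nrm_ge0 x; lra.
have Scomm Z : bounded_operator Z -> (forall x, Z (B (B x)) = B (B (Z x))) ->
    forall x, Z (S x) = S (Z x).
  move=> bZ ZB x; rewrite !SE linearB Vcomm // => y.
  by rewrite !TE ZB.
have SS x : S (S x) = x - B (B x).
  have VVx : V (V x) = V x + V x - B (B x) by rewrite VV TE addrAC subrr add0r.
  rewrite !SE linearB VVx; apply: (@dot_ext _ _ dot) => y.
  by rewrite !dot_lin; ring.
have bddB : bounded_operator B by apply/bounded_nrmP; exists 2^-1.
have bddS : bounded_operator S by apply/bounded_nrmP; exists 2.
have bddJ : bounded_operator J.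
  by apply/bounded_nrmP; exists 1 => x; rewrite mul1r symmetry_isometry.
have sS : self_adjoint dot S by move=> x y; rewrite !SE dotBl dotBr sV.
have BS x : B (S x) = S (B x) by apply: Scomm.
have JS x : J (S x) = S (J x).
  by apply: Scomm => // y; rewrite !JB linearN opprK.
have S0 x : 0 <= complex.Re (dot (S x) x).
  rewrite SE dotBl (dotxx dot_norm) raddfB /= subr_ge0.
  have h : `|dot (V x) x| <= (nrm x ^+ 2)%:C.
    apply: le_trans (cauchy_schwarz dot_norm _ _) _; rewrite lecR expr2.
    rewrite ler_wpM2r ?nrm_ge0 //; have := bV x; have := nrm_ge0 x; lra.
  have := le_trans (normc_ge_Re _) h; rewrite lecR.
  exact: le_trans (ler_norm _).
have [|J' J'E] := @linear_function _ _ (fun x => - J x).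
  by move=> a x y; rewrite linearP opprD scalerN.
have [|P PE] := @linear_function _ _ (fun x => 2^-1%:C *: (x + B x + J (S x))).
  move=> a x y; rewrite !linearP; apply: (@dot_ext _ _ dot) => z.
  by rewrite !dot_lin; ring.
have [|Q QE] := @linear_function _ _ (fun x => 2^-1%:C *: (x + B x + J' (S x))).
  move=> a x y; rewrite !linearP; apply: (@dot_ext _ _ dot) => z.
  by rewrite !dot_lin; ring.
exists P, Q, S; split=> //.
- exact: (@proper_projection B J S P v w).
- apply: (@proper_projection B J' S Q w v) => //.
  + by move=> x y; rewrite !J'E dotNl dotNr sJ.
  + by move=> x; rewrite !J'E [J (- _)]linearN JJ opprK.
  + by move=> x; rewrite !J'E JB [B (- _)]linearN.
  + by move=> x; rewrite !J'E JS [S (- _)]linearN.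
  + by move=> k; rewrite J'E Jw opprK.
  + by move=> k; rewrite J'E Jv.
- move=> x; rewrite PE QE J'E -scalerDr addrACA subrr addr0 scalerDr.
  by rewrite halfD.
- by move=> x; rewrite PE halfD.
Qed.

End projection_pairs.

(** * Block operators over a basis indexed by levels *)

Section block_operators.
Context {R : realType} {H : completeNormedModType R[i]}.
Context {dot : {dot H for Num.conj}} (dot_norm : induces_norm dot).
Implicit Types (x y z l : H) (B C D F G J P Q S T U W Z : {linear H -> H}).

(** [mu] may be negative; this leaves the sum of two such scalars free. *)
Lemma scaled_projection_pair B J (v w : nat -> H) (K mu : R) :
  self_adjoint dot B -> (forall x, nrm (B x) <= K * nrm x) ->
  self_adjoint dot J -> (forall x, J (J x) = x) ->
  (forall x, J (B x) = - B (J x)) ->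
  orthonormal_family (dot := dot) v -> (forall k, J (v k) = v k) ->
  orthonormal_family (dot := dot) w -> (forall k, J (w k) = - w k) ->
  mu != 0 -> K *+ 2 <= `|mu| ->
  exists P Q S, [/\ proper_orthoprojection dot P, proper_orthoprojection dot Q,
    (forall x, mu%:C *: P x + mu%:C *: Q x = mu%:C *: x + B x),
    (forall x, (mu *+ 2)%:C *: P x = mu%:C *: x + B x + mu%:C *: J (S x)) &
    (forall Z, bounded_operator Z -> (forall x, Z (B (B x)) = B (B (Z x))) ->
       forall x, Z (S x) = S (Z x))].
Proof.
move=> sB bB sJ JJ JB vo Jv wo Jw mu0 Kmu.
have mun : 0 < `|mu| by rewrite normr_gt0.
have [|B' BE] := @linear_function _ _ (fun x => mu^-1%:C *: B x).
  by move=> a x y; rewrite linearP scalerDr !scalerA mulrC.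
have Bmu x : mu%:C *: B' x = B x.
  by rewrite BE scalerA -rmorphM divff // rmorph1 scale1r.
have [||//|//||//|//|//|//|P [Q [S [pP pQ PQ PP Scomm]]]] :=
  @projection_pair R H dot dot_norm B' J v w.
- by move=> x y; rewrite !BE dotZl dotZr conj_real sB.
- move=> x; rewrite BE nrmZ normfV ler_pdivrMl //.
  have := bB x; have := nrm_ge0 x; nra.
- by move=> x; rewrite !BE linearZ /= JB scalerN.
exists P, Q, S; split=> //.
- by move=> x; rewrite -scalerDr PQ scalerDr Bmu.
- by move=> x; rewrite mulr2n rmorphD scalerDl -scalerDr PP !scalerDr Bmu.
- move=> Z bZ ZB; apply: Scomm => // x.
  by rewrite !BE !linearZ /= ZB.
Qed.

Context (g : nat * nat -> H).
Context (go : orthonormal_family (dot := dot) g) (gt : total_family (dot := dot) g).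

(** [V k] is the partial isometry from level 0 onto level [k] of the basis, and
[Vs k] is its adjoint. *)
Lemma blocks : exists V Vs : nat -> {linear H -> H}, forall k,
  [/\ is_adjoint dot (V k) (Vs k), (forall x, nrm (V k x) <= nrm x),
    (forall i n, V k (g (i, n)) = if i == 0%N then g (k, n) else 0) &
    (forall i n, Vs k (g (i, n)) = if i == k then g (0%N, n) else 0)].
Proof.
suff h k : exists V : {linear H -> H} * {linear H -> H},
  [/\ is_adjoint dot V.1 V.2, (forall x, nrm (V.1 x) <= nrm x),
    (forall i n, V.1 (g (i, n)) = if i == 0%N then g (k, n) else 0) &
    (forall i n, V.2 (g (i, n)) = if i == k then g (0%N, n) else 0)].
  by have [V HV] := choice h; exists (fun k => (V k).1), (fun k => (V k).2).
have rowo j : orthonormal_family (dot := dot) (fun n => g (j, n)).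
  by move=> m n; rewrite go xpair_eqE eqxx.
have [U [V [UV bU Ug Vg [U0 _]]]] :=
  transfer dot_norm (orthonormal_sub dot_norm (rowo 0%N))
    (orthonormal_sub dot_norm (rowo k)).
have Ugi i n : U (g (i, n)) = if i == 0%N then g (k, n) else 0.
  have [->|i0] := eqVneq i 0%N; first by rewrite Ug (orthonormal_unit _ _ (rowo _)) scale1r.
  by apply: U0 => m; rewrite go xpair_eqE (negPf i0).
exists (U, V); split => //= i n.
apply/eqP; rewrite -subr_eq0; apply/eqP; apply: gt => -[j m].
apply: dot_eq0C; rewrite dotBr -UV Ugi; have [->|j0] := eqVneq j 0%N.
  rewrite go xpair_eqE (eq_sym k); case: eqP => _; rewrite ?dot0r ?subr0 //.
  by rewrite go xpair_eqE eqxx subrr.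
rewrite dot0l; case: eqP => _; rewrite ?dot0r ?subr0 //.
by rewrite go xpair_eqE (negPf j0) subr0.
Qed.

Context (V Vs : nat -> {linear H -> H}).
Context (VP : forall k,
  [/\ is_adjoint dot (V k) (Vs k), (forall x, nrm (V k x) <= nrm x),
    (forall i n, V k (g (i, n)) = if i == 0%N then g (k, n) else 0) &
    (forall i n, Vs k (g (i, n)) = if i == k then g (0%N, n) else 0)]).
Context (C : {linear H -> H}) (M : R).
Context (sC : self_adjoint dot C) (M0 : 0 <= M)
  (bC : forall x, nrm (C x) <= M * nrm x).

Let Vadj k : is_adjoint dot (V k) (Vs k). Proof. by have [] := VP k. Qed.
Let Vsadj k : is_adjoint dot (Vs k) (V k).
Proof. by move=> x y; rewrite dotC -Vadj -dotC. Qed.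
Let bV k x : nrm (V k x) <= nrm x. Proof. by have [_ + _ _] := VP k. Qed.
Let Vg k i n : V k (g (i, n)) = if i == 0%N then g (k, n) else 0.
Proof. by have [_ _ + _] := VP k. Qed.
Let Vsg k i n : Vs k (g (i, n)) = if i == k then g (0%N, n) else 0.
Proof. by have [_ _ _ +] := VP k. Qed.

Let VsV j k x : j != k -> Vs j (V k x) = 0.
Proof.
move=> jk; move: x; apply: (eq_total (f := fun x => Vs j (V k x)) (f' := fun=> 0)
  (fs := fun x => Vs k (V j x)) (fs' := fun=> 0) gt).
- by move=> x y; rewrite Vsadj Vadj.
- by move=> x y; rewrite dot0l dot0r.
- case=> i n; rewrite Vg; case: eqP => _; last by rewrite linear0.
  by rewrite Vsg eq_sym (negPf jk).
Qed.

(** The block-diagonal operator whose block at level [k] is [eps k] times the level-0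
block of [C], carried to level [k] by [V k]: the strong sum of
[eps k V_k C V_k^*]. *)
Lemma block_operator (eps : nat -> R) : (forall k, `|eps k| <= 1) ->
  exists W, [/\ self_adjoint dot W, (forall x, nrm (W x) <= M * nrm x) &
    forall k n, W (g (k, n)) = (eps k)%:C *: V k (C (g (0%N, n)))].
Proof.
move=> eps1; pose f k x := (eps k)%:C *: V k (C (Vs k x)).
have [//||||W [HW bW]] := @orthogonal_sum R H dot dot_norm f M.
- by move=> k a x y; rewrite /f !linearP /= !scalerA mulrC.
- by move=> x j k jk; rewrite /f dotZl dotZr Vadj VsV // dot0r !mulr0.
- move=> x n; rewrite exprMn.
  have h : \sum_(0 <= k < n) nrm (Vs k x) ^+ 2 <= nrm x ^+ 2.
    apply: (bessel dot_norm x (fun k => V k (Vs k x)) (fun k => nrm (Vs k x))) => //.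
    + by move=> j k jk; rewrite Vadj VsV // dot0r.
    + by move=> k; rewrite -Vsadj (dotxx dot_norm).
  apply: le_trans (ler_wpM2l (sqr_ge0 M) h); rewrite mulr_sumr.
  apply: ler_sum => k _; rewrite -exprMn; apply: lerXn2r.
  + by rewrite nnegrE nrm_ge0.
  + by rewrite nnegrE mulr_ge0 // nrm_ge0.
  + rewrite nrmZ; apply: le_trans (bC (Vs k x)).
    apply: le_trans (bV k (C (Vs k x))).
    by rewrite ler_piMl ?nrm_ge0.
exists W; split=> //.
- apply: (strong_limit_adjoint dot_norm _ _ _ _ _ HW HW) => n x y.
  rewrite dot_suml dot_sumr; apply: eq_bigr => k _.
  by rewrite /f dotZl dotZr conj_real Vadj sC Vsadj.
- move=> k n; apply: (cvg_unique _ (HW (g (k, n)))) => //.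
  apply/cvg_nrmP => e e0; exists k.+1 => N kN.
  rewrite (bigD1_seq k) ?mem_index_iota ?iota_uniq //=.
  rewrite {1}/f Vsg eqxx big1 ?addr0 ?subrr ?nrm0 //.
  by move=> j jk; rewrite /f Vsg eq_sym (negPf jk) !linear0.
Qed.

(** Here [J] permutes the levels by [tau].  The levels [p] and [tau p] provide the
eigenvectors [(g (p, n) + g (tau p, n)) / sqrt 2] and
[(g (p, n) - g (tau p, n)) / sqrt 2] of [J]. *)
Lemma antisymmetric_block_operator (eps : nat -> R) (d : nat * nat -> R)
    (tau : nat -> nat) (p : nat) :
  (forall k, `|eps k| <= 1) -> (forall t, `|d t| <= 1) ->
  involutive tau -> tau p != p ->
  (forall k, eps (tau k) = - eps k) -> (forall k n, d (tau k, n) = - d (k, n)) ->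
  exists B J (v w : nat -> H),
  [/\ (forall k n, B (g (k, n)) =
          (eps k)%:C *: V k (C (g (0%N, n))) + (d (k, n))%:C *: g (k, n)),
      self_adjoint dot B, (forall x, nrm (B x) <= (M + 1) * nrm x),
      (self_adjoint dot J /\ (forall x, J (J x) = x)) &
  [/\ (forall x, J (B x) = - B (J x)),
      orthonormal_family (dot := dot) v, (forall k, J (v k) = v k),
      orthonormal_family (dot := dot) w & (forall k, J (w k) = - w k)]].
Proof.
move=> eps1 d1 tauK taup epsN dN.
have [W [sW bW Wg]] := block_operator eps eps1.
have [D [bD sD Dg]] := diagonal_operator dot_norm g d go gt d1.
have [|B BE] := @linear_function _ _ (fun x => W x + D x).
  by move=> a x y; rewrite !linearP scalerDr addrACA.
pose tau2 (t : nat * nat) := (tau t.1, t.2).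
have [|J [bJ sJ JJ Jg]] := permutation_symmetry dot_norm g tau2 go gt.
  by case=> k n; rewrite /tau2 /= tauK.
have sB : self_adjoint dot B by move=> x y; rewrite !BE dotDl dotDr sW sD.
have JV k x : J (V k x) = V (tau k) x.
  move: x; apply: (eq_total (f := fun x => J (V k x)) (f' := V (tau k))
    (fs := fun x => Vs k (J x)) (fs' := Vs (tau k)) gt).
  - by move=> x y; rewrite sJ Vadj.
  - by move=> x y; rewrite Vadj.
  - case=> i n; rewrite !Vg; case: eqP => _; last by rewrite linear0.
    by rewrite Jg.
have Bg k n : B (g (k, n)) =
    (eps k)%:C *: V k (C (g (0%N, n))) + (d (k, n))%:C *: g (k, n).
  by rewrite BE Wg Dg.
pose r : R := (Num.sqrt 2)^-1.
have rr : r%:C * (r%:C * 2) = 1 :> R[i].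
  have -> : 2 = 2%:C :> R[i] by rewrite rmorph_nat.
  by rewrite -!rmorphM /r mulrA -invfM -expr2 sqr_sqrtr // mulVf ?rmorph1 //.
have rrD a : r%:C * (r%:C * (a + a)) = a by rewrite -[RHS]mul1r -rr; ring.
have ptau : p != tau p by rewrite eq_sym.
exists B, J, (fun n => r%:C *: (g (p, n) + g (tau p, n))),
  (fun n => r%:C *: (g (p, n) - g (tau p, n))); split=> //.
- move=> x; rewrite BE mulrDl mul1r; apply: le_trans (nrmD _ _) _.
  exact: lerD.
- split=> //.
  + apply: (eq_total (f := fun x => J (B x)) (f' := fun x => - B (J x))
      (fs := fun x => B (J x)) (fs' := fun x => - J (B x)) gt).
    * by move=> x y; rewrite sJ sB.
    * by move=> x y; rewrite dotNl dotNr sB sJ.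
    * case=> k n; rewrite Jg /tau2 /= !Bg epsN dN linearD !linearZ /= JV Jg.
      by rewrite !rmorphN !scaleNr opprD !opprK.
  + move=> m n; rewrite dotZl dotZr conj_real dotDl !dotDr !go !xpair_eqE !eqxx.
    by rewrite (negPf taup) (negPf ptau) /= addr0 add0r rrD.
  + by move=> n; rewrite linearZ linearD /= !Jg /tau2 /= tauK addrC.
  + move=> m n; rewrite dotZl dotZr conj_real dotBl !dotBr !go !xpair_eqE !eqxx.
    by rewrite (negPf taup) (negPf ptau) /= subr0 sub0r opprK rrD.
  + by move=> n; rewrite linearZ linearB /= !Jg /tau2 /= tauK -scalerN opprB.
Qed.

End block_operators.

(** * The swindle *)

Section eigenvectors.
Context {R : realType} {H : completeNormedModType R[i]}.
Context {dot : {dot H for Num.conj}} (dot_norm : induces_norm dot).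
Implicit Types (x y z l : H) (A B C D E F G J P Q S T U V W Z : {linear H -> H}).

(** The two pairings of the levels are [{0, 1}, {2, 3}, ...] and [{1, 2}, {3, 4}, ...]
with 0 left alone.  In pairing [i], level [k] is exchanged with [leveli k] and
carries [signi k] times [T (basei k)], where [T] is the sequence of operators of
the introduction. *)
Let level1 k := if odd k then k.-1 else k.+1.
Let sign1 k : R := if odd k then -1 else 1.
Let base1 k := if odd k then k.-1 else k.
Let level2 k := if k == 0%N then 0%N else if odd k then k.+1 else k.-1.
Let sign2 k : R := if k == 0%N then 0 else if odd k then 1 else -1.
Let base2 k := if k == 0%N then 0%N else if odd k then k else k.-1.

(** [B1] and [B2] combine the level-0 block of [C] with the diagonal weights [gam n m],
the partial sums of the eigenvalues along the column [n]; the decay [2^-1 ^+ k] keeps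
these sums below 1.  At level [k > 0] the two level-0 blocks cancel and the weights
leave [gam n k - gam n k.-1 = c (k, n)]. *)
Lemma four_projections (g : nat * nat -> H) C (c : nat * nat -> R) (d : R) :
  orthonormal_family (dot := dot) g -> total_family (dot := dot) g ->
  self_adjoint dot C -> bounded_operator C ->
  (forall k n, (0 < k)%N -> C (g (k, n)) = (c (k, n))%:C *: g (k, n)) ->
  (forall k n, (0 < k)%N -> `|c (k, n)| <= 2^-1 ^+ k) ->
  exists (mu nu : R) P1 Q1 P2 Q2,
    [/\ proper_orthoprojection dot P1, proper_orthoprojection dot Q1,
        proper_orthoprojection dot P2, proper_orthoprojection dot Q2 &
        forall x, C x + d%:C *: x =
          mu%:C *: P1 x + mu%:C *: Q1 x + (nu%:C *: P2 x + nu%:C *: Q2 x)].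
Proof.
move=> go gt sC /bounded_nrmP [M' bC'] Cg c2.
pose M := `|M'|.
have M0 : 0 <= M by exact: normr_ge0.
have bC x : nrm (C x) <= M * nrm x.
  by apply: le_trans (bC' x) _; rewrite ler_wpM2r ?nrm_ge0 // ler_norm.
pose gam n m := \sum_(1 <= j < m.+1) c (j, n).
have gamS n m : gam n m.+1 = gam n m + c (m.+1, n).
  by rewrite /gam big_nat_recr.
have gam1 n m : `|gam n m| <= 1.
  suff h : `|gam n m| <= 1 - 2^-1 ^+ m.
    by apply: le_trans h _; rewrite gerBl exprn_ge0 ?invr_ge0.
  elim: m => [|m IH]; first by rewrite /gam big_geq // normr0 expr0 subrr.
  rewrite gamS; have := ler_normD (gam n m) (c (m.+1, n)).
  by have := c2 m.+1 n isT; rewrite exprS; lra.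
have sgn1 k : `|sign1 k| <= 1 by rewrite /sign1; case: odd; rewrite ?normrN1 ?normr1.
have sgn2 k : `|sign2 k| <= 1.
  by rewrite /sign2; case: eqP => _; [rewrite normr0|case: odd; rewrite ?normrN1 ?normr1].
have [V [Vs VP]] := blocks dot_norm g go gt.
have l1K : involutive level1 by move=> k; rewrite /level1; do ! case: ifP; lia.
have l2K : involutive level2 by move=> k; rewrite /level2; do ! case: ifP; lia.
have b1K k : base1 (level1 k) = base1 k by rewrite /base1 /level1; do ! case: ifP; lia.
have b2K k : base2 (level2 k) = base2 k by rewrite /base2 /level2; do ! case: ifP; lia.
have s1N k : sign1 (level1 k) = - sign1 k.
  rewrite /sign1 (_ : odd (level1 k) = ~~ odd k); last by rewrite /level1; case: ifP; lia.
  by case: odd; rewrite /= ?opprK.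
have s2N k : sign2 (level2 k) = - sign2 k.
  case: k => [|k]; first by rewrite /sign2 /= oppr0.
  have -> : sign2 (level2 k.+1) = if odd (level2 k.+1) then 1 else -1.
    by rewrite /sign2 (_ : (level2 k.+1 == 0%N) = false) // /level2 /=; case: ifP; lia.
  rewrite (_ : odd (level2 k.+1) = ~~ odd k.+1); last by rewrite /level2 /=; case: ifP; lia.
  by rewrite /sign2 /=; case: odd; rewrite /= ?opprK.
have antisym := antisymmetric_block_operator dot_norm g go gt V Vs VP C M sC M0 bC.
have [||||||B1 [J1 [v1 [w1 [B1g sB1 bB1 [sJ1 JJ1] [JB1 v1o Jv1 w1o Jw1]]]]]] :=
  antisym sign1 (fun t => sign1 t.1 * gam t.2 (base1 t.1)) level1 0%N => //=.
- by move=> t; rewrite normrM mulr_ile1.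
- by move=> k n; rewrite s1N b1K mulNr.
have [||||||B2 [J2 [v2 [w2 [B2g sB2 bB2 [sJ2 JJ2] [JB2 v2o Jv2 w2o Jw2]]]]]] :=
  antisym sign2 (fun t => sign2 t.1 * gam t.2 (base2 t.1)) level2 1%N => //=.
- by move=> t; rewrite normrM mulr_ile1.
- by move=> k n; rewrite s2N b2K mulNr.
(* The images of the other levels lie in these levels, so [C] preserves level 0. *)
have V0 n : V 0%N (C (g (0%N, n))) = C (g (0%N, n)).
  have [VV _ _ Vsg] := VP 0%N.
  apply/eqP; rewrite -subr_eq0; apply/eqP; apply: gt => -[k m].
  rewrite dotBl VV Vsg; case: eqP => [->|/eqP k0]; first by rewrite subrr.
  by rewrite dot0r sC Cg ?lt0n // dotZr go xpair_eqE eq_sym (negPf k0) mulr0 subrr.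
have CB x : C x = B1 x + B2 x.
  move: x; apply: (eq_total (f := C) (fs := C) (f' := fun x => B1 x + B2 x)
    (fs' := fun x => B1 x + B2 x) gt) => //.
    by move=> x y; rewrite dotDl dotDr sB1 sB2.
  case=> k n; rewrite B1g B2g /=.
  case: k => [|k].
    rewrite /sign1 /sign2 /base1 /= /gam big_geq // mulr0 mul0r rmorph1 rmorph0.
    by rewrite !scale0r scale1r !addr0 V0.
  rewrite addrACA -!scalerDl -!rmorphD /=.
  have -> : sign1 k.+1 + sign2 k.+1 = 0.
    by rewrite /sign1 /sign2 /=; case: odd; rewrite /= ?subrr ?addNr.
  rewrite rmorph0 scale0r add0r Cg //; congr (_%:C *: _).
  by rewrite /sign1 /sign2 /base1 /base2 /=; case: odd; rewrite /= gamS; ring.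
pose K := M + 1.
have K0 : 0 < K by rewrite /K; lra.
pose mu := K *+ 2 + `|d|; pose nu := d - mu.
have mu0 : 0 < mu by rewrite /mu; have := normr_ge0 d; lra.
have nu0 : nu < 0 by rewrite /nu /mu; have := ler_norm d; lra.
have [||P1 [Q1 [S1 [pP1 pQ1 PQ1 _ _]]]] :=
  @scaled_projection_pair R H dot dot_norm B1 J1 v1 w1 K mu
    sB1 bB1 sJ1 JJ1 JB1 v1o Jv1 w1o Jw1.
- by rewrite gt_eqF.
- by rewrite gtr0_norm // /mu; have := normr_ge0 d; lra.
have [||P2 [Q2 [S2 [pP2 pQ2 PQ2 _ _]]]] :=
  @scaled_projection_pair R H dot dot_norm B2 J2 v2 w2 K nu
    sB2 bB2 sJ2 JJ2 JB2 v2o Jv2 w2o Jw2.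
- by rewrite lt_eqF.
- by rewrite ltr0_norm // /nu /mu; have := ler_norm d; lra.
exists mu, nu, P1, Q1, P2, Q2; split=> // x.
by rewrite PQ1 PQ2 CB addrACA -scalerDl -rmorphD /nu addrC subrKC.
Qed.

(** A vector orthogonal to a dense set is at distance at least its own norm from every
point of that set. *)
Lemma separable_total : separable H -> exists u : nat -> H, total_family (dot := dot) u.
Proof.
move=> [D /countable_injP [f finj] Dd].
pose u n := xget 0 (D `&` [set y | f y = n]).
have uf y : D y -> u (f y) = y.
  move=> Dy; rewrite /u; case: xgetP => [z _ [Dz fz]|/(_ y)]; last by case.
  by apply: finj; rewrite ?inE.
exists u => x xu.
apply: nrm_eq0; apply/eqP; rewrite eq_le nrm_ge0 andbT leNgt; apply/negP => x0.
have /Dd : ball x (nrm x)%:C !=set0 by exists x; apply: ballxx; rewrite ltcR.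
case=> [|z [xz Dz]]; first by apply: ball_open; rewrite ltcR.
have xz0 : dot x z = 0%:C by rewrite -(uf z Dz) xu.
move: xz; rewrite -ball_normE /= nrmE ltcR => xz.
have := nrm_sqrB dot_norm x z 0 xz0; rewrite mul0rn subr0.
have := nrm_ge0 z; have := nrm_ge0 (x - z); move: x0 xz.
move: (nrm _) (nrm _) (nrm _) => a b c; nra.
Qed.

(** An index sequence that is injective and as late as prescribed. *)
Let spread (th : nat -> nat) :
  exists2 psi : nat -> nat, injective psi & forall i, (th i <= psi i)%N.
Proof.
pose psi i := (i + \sum_(0 <= j < i.+1) th j)%N.
have psiS i : (psi i < psi i.+1)%N.
  by rewrite /psi [in X in (_ < X)%N]big_nat_recr //=; lia.
exists psi; last by move=> i; rewrite /psi big_nat_recr //=; lia.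
have mono : {homo psi : m n / (m < n)%N} by apply: homo_ltn => // ? ? ?; apply: ltn_trans.
move=> m n mn; case: (ltngtP m n) => // /mono; rewrite mn ltnn //.
Qed.

(** Bolzano-Weierstrass gives the limit [d]; the array takes at position [(k, n)] an
eigenvector far enough along the convergent subsequence for the bound [2^-k],
without repetition. *)
Lemma eigenvalue_accumulation C (e : nat -> H) (c : nat -> R) :
  bounded_operator C -> orthonormal_family (dot := dot) e ->
  (forall n, C (e n) = (c n)%:C *: e n) ->
  exists (d : R) (h : nat * nat -> H) (b : nat * nat -> R),
  [/\ orthonormal_family (dot := dot) h,
    (forall t, C (h t) - d%:C *: h t = (b t)%:C *: h t) &
    forall k n, `|b (k, n)| <= 2^-1 ^+ k].
Proof.
move=> /bounded_nrmP [M bC] eo Ce.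
have [|f fincr /cvg_ex[/= d /cvgrPdist_lt cfd]] := @bolzano_weierstrass R c.
  exists M; split; first exact: num_real.
  move=> y My n _ /=; apply: le_trans (ltW My).
  have := bC (e n); rewrite Ce nrmZ.
  by rewrite (nrm_unit dot_norm (e n) (orthonormal_unit e n eo)) !mulr1.
have finj : injective f by apply: inc_inj => m n; rewrite fincr.
have /choice [N HN] k : exists N, forall n, (N <= n)%N -> `|d - c (f n)| < 2^-1 ^+ k.
  have /cfd [N _ h] : 0 < (2^-1 : R) ^+ k by rewrite exprn_gt0 ?invr_gt0.
  by exists N => n; exact: h.
pose th i := N (if @unpickle (nat * nat)%type i is Some (k, _) then k else 0%N : nat).
have [psi psi_inj psi_th] := spread th.
pose phi (t : nat * nat) := f (psi (pickle t)).
exists d, (e \o phi), (fun t => c (phi t) - d); split.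
- move=> s t; rewrite /= eo; congr (_%:R); congr nat_of_bool.
  by rewrite (inj_eq finj) (inj_eq psi_inj) (inj_eq (pcan_inj pickleK)).
- by move=> t; rewrite /= Ce rmorphB scalerBl.
- move=> k n; rewrite distrC ltW // HN //.
  by have := psi_th (pickle (k, n)); rewrite /th pickleK.
Qed.

(** Let [f] be the Gram-Schmidt family of the components of a dense sequence orthogonal
to the rows [k > 0] of [h].  The column [n] of [g] is [f n] followed by the column
[n] of these rows or, when [f n = 0], just the latter, moved up by one level. *)
Lemma extend_to_basis (h : nat * nat -> H) : separable H ->
  orthonormal_family (dot := dot) h ->
  exists (g : nat * nat -> H),
  [/\ orthonormal_family (dot := dot) g, total_family (dot := dot) g &
    forall k n, (0 < k)%N -> g (k, n) = h (k, n) \/ g (k, n) = h (k.+1, n)].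
Proof.
move=> Hsep ho.
pose h1 (t : nat * nat) := h (t.1.+1, t.2).
have h1o : orthonormal_family (dot := dot) h1.
  by move=> [k n] [j m]; rewrite ho !xpair_eqE.
have [E [sE bE EE Eh E0]] := span_projection dot_norm h1 h1o.
have [u ut] := separable_total Hsep.
have [f [fo fu fs fh]] := gram_schmidt dot_norm (fun n => u n - E (u n)).
have hf t n : dot (h1 t) (f n) = 0.
  by apply: fh => k _; rewrite dotBr -sE Eh subrr.
have fh' t n : dot (f n) (h1 t) = 0 by apply: dot_eq0C.
pose g (t : nat * nat) :=
  if f t.2 == 0 then h1 t else if t.1 is k.+1 then h1 (k, t.2) else f t.2.
have h1E k n j m : dot (h1 (k, n)) (h1 (j, m)) = ((k == j) && (n == m))%:R.
  by rewrite h1o xpair_eqE.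
exists g; split.
- move=> [k n] [j m]; rewrite /g xpair_eqE /=.
  have [fn|fn] := eqVneq (f n) 0; have [fm|fm] := eqVneq (f m) 0.
  + exact: h1E.
  + have nm : (n == m) = false by apply: contra_neqF fm => /eqP <-.
    by case: j => [|j]; rewrite ?hf ?h1E nm !andbF.
  + have nm : (n == m) = false by apply: contra_neqF fn => /eqP ->.
    by case: k => [|k]; rewrite ?fh' ?h1E nm !andbF.
  + case: k => [|k]; case: j => [|j]; rewrite ?fh' ?hf ?h1E ?eqSS //=.
    have [<-|nm] := eqVneq n m; last by rewrite fo.
    by case: (fu n) => // fn0; rewrite fn0 eqxx in fn.
- move=> x xg; apply: ut => n.
  have xh t : dot x (h1 t) = 0.
    case: t => k m; have [fm|fm] := eqVneq (f m) 0.
      by have := xg (k, m); rewrite /g /= fm eqxx.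
    by have := xg (k.+1, m); rewrite /g /= (negPf fm).
  have xf m : dot x (f m) = 0.
    have [->|fm] := eqVneq (f m) 0; first by rewrite dot0r.
    by have := xg (0%N, m); rewrite /g /= (negPf fm).
  have := fs x n (fun k _ => xf k).
  by rewrite dotBr -sE (E0 x xh) dot0l subr0.
- move=> [//|k] n _; rewrite /g /=; case: eqP => _; [by right|by left].
Qed.

End eigenvectors.

(** * Reduction to an operator with an orthonormal sequence of eigenvectors *)

Section reduction.
Context {R : realType} {H : completeNormedModType R[i]}.
Context {dot : {dot H for Num.conj}} (dot_norm : induces_norm dot).
Implicit Types (x y z l : H) (A B C D E F G J P Q S T U V W Z : {linear H -> H}).

Lemma eigenvector_sum_of_four C (e : nat -> H) (c : nat -> R) :
  separable H -> self_adjoint dot C -> bounded_operator C ->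
  orthonormal_family (dot := dot) e ->
  (forall n, C (e n) = (c n)%:C *: e n) ->
  exists (mu nu : R) P1 Q1 P2 Q2,
    [/\ proper_orthoprojection dot P1, proper_orthoprojection dot Q1,
        proper_orthoprojection dot P2, proper_orthoprojection dot Q2 &
        forall x, C x =
          mu%:C *: P1 x + mu%:C *: Q1 x + (nu%:C *: P2 x + nu%:C *: Q2 x)].
Proof.
move=> Hsep sC bC eo Ce.
have [d [h [b [ho Ch b2]]]] := eigenvalue_accumulation dot_norm C e c bC eo Ce.
have [g [go gt gh]] := extend_to_basis dot_norm h Hsep ho.
have [|D DE] := @linear_function _ _ (fun x => C x - d%:C *: x).
  move=> a x y; rewrite linearP; apply: (@dot_ext _ _ dot) => z.
  by rewrite !dot_lin; ring.
have sD : self_adjoint dot D.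
  by move=> x y; rewrite !DE dotBl dotBr sC dotZl dotZr conj_real.
have bD : bounded_operator D.
  have [M bM] := (bounded_nrmP C).1 bC; apply/bounded_nrmP; exists (M + `|d|) => x.
  rewrite DE mulrDl -nrmZ; apply: le_trans (nrmB _ _) _.
  exact: lerD.
have bg t : (0 < t.1)%N -> exists r : R,
    D (g t) = r%:C *: g t /\ `|r| <= 2^-1 ^+ t.1.
  case: t => k n /= k0; case: (gh k n k0) => ->; rewrite DE Ch.
    by exists (b (k, n)); split.
  exists (b (k.+1, n)); split=> //; apply: le_trans (b2 _ _) _.
  have : 0 <= (2^-1 : R) ^+ k by rewrite exprn_ge0 ?invr_ge0.
  rewrite exprS; lra.
have /choice [r Hr] t : exists r : R, (0 < t.1)%N ->
    D (g t) = r%:C *: g t /\ `|r| <= 2^-1 ^+ t.1.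
  by case: (posnP t.1) => [->|/bg [r Hr]]; [exists 0 | exists r].
have [||mu [nu [P1 [Q1 [P2 [Q2 [p1 q1 p2 q2 DS]]]]]]] :=
  four_projections dot_norm g D r d go gt sD bD.
- by move=> k n k0; have [] := Hr (k, n) k0.
- by move=> k n k0; have [] := Hr (k, n) k0.
exists mu, nu, P1, Q1, P2, Q2; split=> // x.
by rewrite -DS DE subrK.
Qed.

(** Each vector is chosen orthogonal to the finitely many [a m], [A (a m)],
[A (A (a m))] already present; self-adjointness makes the conditions symmetric. *)
Lemma orthonormal_krylov A : infinite_dimensional [set: H] -> self_adjoint dot A ->
  exists a : nat -> H, orthonormal_family (dot := dot) a /\
    forall m n, m != n ->
      dot (A (a m)) (a n) = 0 /\ dot (A (A (a m))) (a n) = 0.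
Proof.
move=> Hinf sA.
have /choice [pick Hp] := fun s => exists_unit_orthogonal dot_norm s Hinf.
pose prev := fix prev n := if n is m.+1 then
  let x := pick (prev m) in [:: x, A x, A (A x) & prev m] else [::].
pose a n := pick (prev n).
have prevP n m : (m < n)%N ->
    [/\ a m \in prev n, A (a m) \in prev n & A (A (a m)) \in prev n].
  elim: n => // n IH; rewrite ltnS leq_eqVlt => /orP[/eqP ->|/IH [h1 h2 h3]].
    by rewrite /= !inE !eqxx !orbT.
  by rewrite /= !inE h1 h2 h3 !orbT.
have lt n m : (m < n)%N -> [/\ dot (a n) (a m) = 0, dot (a n) (A (a m)) = 0 &
    dot (a n) (A (A (a m))) = 0].
  by move=> /prevP [h1 h2 h3]; have [_ o] := Hp (prev n); split; apply: o.
exists a; split=> m n.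
  have [->|mn] := eqVneq m n; first by have [] := Hp (prev n).
  case: (ltngtP m n) mn => // [/lt [h _ _]|/lt [h _ _]] _ //.
  exact: dot_eq0C.
rewrite neq_ltn => /orP[/lt [_ h1 h2]|/lt [_ h1 h2]].
  by split; apply: dot_eq0C.
by rewrite !sA.
Qed.

(** Here [B] is the off-diagonal part of [A] with respect to [E].  Since [mu] times
[2 P] is [mu + B + mu J S], the operator [C] is the diagonal part of [A] minus
[mu + mu J S]. *)
Lemma eigenvector_reduction A : infinite_dimensional [set: H] ->
  bounded_operator A -> self_adjoint dot A ->
  exists (lam : R) P C (e : nat -> H) (c : nat -> R),
  [/\ proper_orthoprojection dot P,
      (forall x, A x = lam%:C *: P x + C x),
      self_adjoint dot C /\ bounded_operator C,
      orthonormal_family (dot := dot) e &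
      forall n, C (e n) = (c n)%:C *: e n].
Proof.
move=> Hinf bddA sA.
have [a [ao Aa]] := orthonormal_krylov A Hinf sA.
pose e n := a n.*2; pose w n := a n.*2.+1.
have eo : orthonormal_family (dot := dot) e.
  by move=> m n; rewrite ao; congr (nat_of_bool _)%:R; apply/eqP/eqP; lia.
have wo : orthonormal_family (dot := dot) w.
  by move=> m n; rewrite ao; congr (nat_of_bool _)%:R; apply/eqP/eqP; lia.
have [E [sE bE EE Ee E0]] := span_projection dot_norm e eo.
have Ew n : E (w n) = 0.
  by apply: E0 => m; rewrite ao (_ : (_ == _) = false) //; apply/eqP; lia.
have Ediag y n : (forall m, m != n -> dot y (e m) = 0) -> E y = dot y (e n) *: e n.
  move=> yo; apply/eqP; rewrite -subr_eq0; apply/eqP.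
  transitivity (E (y - dot y (e n) *: e n)).
    by rewrite [E (_ - _)]linearB [E (_ *: _)]linearZ /= Ee.
  apply: E0 => m; rewrite dotBl dotZl eo.
  by have [->|mn] := eqVneq m n; rewrite ?mulr1 ?subrr // yo // mulr0 subr0.
have [|J JE] := @linear_function _ _ (fun x => E x + E x - x).
  by move=> b x y; rewrite linearP; apply: (@dot_ext _ _ dot) => z; rewrite !dot_lin; ring.
have sJ : self_adjoint dot J.
  by move=> x y; rewrite !JE !(dotDl, dotDr, dotBl, dotBr, dotNl, dotNr) sE.
have JJ x : J (J x) = x.
  rewrite !JE !(linearB, linearD) /= !EE; apply: (@dot_ext _ _ dot) => z.
  by rewrite !dot_lin; ring.
(* [E A (1 - E) + (1 - E) A E], expanded. *)
have [|B BE] := @linear_function _ _ (fun x => E (A x) + A (E x) - (E (A (E x)) *+ 2)).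
  move=> b x y; rewrite !linearP !mulr2n; apply: (@dot_ext _ _ dot) => z.
  by rewrite !dot_lin; ring.
have {}BE x : B x = E (A x) + A (E x) - (E (A (E x)) + E (A (E x))) by rewrite BE.
have sB : self_adjoint dot B.
  move=> x y; rewrite !BE !(dotDl, dotDr, dotBl, dotBr, dotNl, dotNr) !(sE, sA); ring.
have JB x : J (B x) = - B (J x).
  rewrite !(BE, JE) !(linearB, linearD) /= !EE; apply: (@dot_ext _ _ dot) => z.
  by rewrite !dot_lin; ring.
have [M bA] := (bounded_nrmP A).1 bddA.
pose N := `|M|.
have N0 : 0 <= N by exact: normr_ge0.
have bAN x : nrm (A x) <= N * nrm x.
  by apply: le_trans (bA x) _; rewrite ler_wpM2r ?nrm_ge0 // ler_norm.
have bB x : nrm (B x) <= (4 * N) * nrm x.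
  rewrite BE; have := nrmB (E (A x) + A (E x)) (E (A (E x)) + E (A (E x))).
  have := nrmD (E (A x)) (A (E x)); have := nrmD (E (A (E x))) (E (A (E x))).
  have := bE (A x); have := bAN x; have := bAN (E x); have := bE (A (E x)).
  have : N * nrm (E x) <= N * nrm x by rewrite ler_wpM2l.
  lra.
pose mu := 8 * N + 1.
have [||||P [Q [S [pP _ _ PS Scomm]]]] :=
  @scaled_projection_pair R H dot dot_norm B J e w (4 * N) mu sB bB sJ JJ JB eo _ wo.
- by move=> k; rewrite JE Ee addrK.
- by move=> k; rewrite JE Ew addr0 sub0r.
- by rewrite gt_eqF // /mu; lra.
- by rewrite ger0_norm /mu; lra.
have [[bP sP PP] _ _] := pP.
have [|C CE] := @linear_function _ _ (fun x => A x - (mu *+ 2)%:C *: P x).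
  move=> b x y; rewrite !linearP; apply: (@dot_ext _ _ dot) => z.
  by rewrite !dot_lin; ring.
have sC : self_adjoint dot C.
  by move=> x y; rewrite !CE dotBl dotBr sA dotZl dotZr conj_real sP.
have bC : bounded_operator C.
  have [K bK] := (bounded_nrmP P).1 bP.
  apply/bounded_nrmP; exists (N + `|mu *+ 2| * K) => x; rewrite CE mulrDl -mulrA.
  apply: le_trans (nrmB _ _) _; rewrite nrmZ lerD // ler_wpM2l //.
have Ce n : exists k : R[i], C (e n) = k *: e n.
  pose al := dot (A (e n)) (e n).
  have Aen m : m != n -> dot (A (e n)) (e m) = 0 /\ dot (A (A (e n))) (e m) = 0.
    by move=> mn; apply: Aa; lia.
  have EAe : E (A (e n)) = al *: e n by apply: Ediag => m /Aen [].
  have EAAe : E (A (A (e n))) = dot (A (A (e n))) (e n) *: e n.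
    by apply: Ediag => m /Aen [].
  have Be : B (e n) = A (e n) - al *: e n.
    by rewrite BE Ee EAe; apply: (@dot_ext _ _ dot) => z; rewrite !dot_lin; ring.
  have EB : E (B (e n)) = 0 by rewrite Be linearB linearZ /= EAe Ee subrr.
  have [k BBe] : exists k, B (B (e n)) = k *: e n.
    exists (dot (A (A (e n))) (e n) - al * al).
    rewrite BE EB !linear0 !addr0 subr0 Be.
    rewrite [A (_ - _)]linearB [A (_ *: _)]linearZ.
    rewrite [E (_ - _)]linearB [E (_ *: _)]linearZ /= EAAe EAe.
    by apply: (@dot_ext _ _ dot) => z; rewrite !dot_lin; ring.
  have kr : (k^*)%R = k.
    have : dot (B (B (e n))) (e n) = dot (e n) (B (B (e n))) by rewrite !sB.
    by rewrite BBe dotZl dotZr eo eqxx !mulr1.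
  (* The projection [Z] onto the line of [e n] commutes with [B^2], hence with [S],
     so [S] maps that line to itself. *)
  have [|Z ZE] := @linear_function _ _ (fun x => dot x (e n) *: e n).
    by move=> b x y; rewrite dotDl dotZl scalerDl scalerA.
  have bZ : bounded_operator Z.
    apply/bounded_nrmP; exists 1 => x; rewrite ZE nrmcZ mul1r.
    have ne := nrm_unit dot_norm (e n) (orthonormal_unit e n eo).
    rewrite ne mulr1 -lecR RRe_real ?normr_real //.
    by have := cauchy_schwarz dot_norm x (e n); rewrite ne mulr1.
  have ZB x : Z (B (B x)) = B (B (Z x)).
    by rewrite !ZE !linearZ /= BBe sB sB BBe dotZr kr scalerA mulrC.
  have [s Se] : exists s, S (e n) = s *: e n.
    by exists (dot (S (e n)) (e n)); rewrite -ZE Scomm // ZE eo eqxx scale1r.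
  exists (al - mu%:C - mu%:C * s).
  rewrite CE PS Be Se [J _]linearZ /= JE Ee addrK.
  apply: (@dot_ext _ _ dot) => z; rewrite !dot_lin; ring.
have /choice [c Hc] n : exists k : R, C (e n) = k%:C *: e n.
  have [k Ck] := Ce n; exists (complex.Re k).
  (* The eigenvalues of a self-adjoint operator are real. *)
  rewrite RRe_real // CrealE; apply/eqP.
  by have := sC (e n) (e n); rewrite Ck dotZl dotZr eo eqxx !mulr1.
exists (mu *+ 2), P, C, e, c; split=> // x.
by rewrite CE addrC subrK.
Qed.

End reduction.

Theorem corollary3p3 (R : realType) (H : completeNormedModType R[i])
    (dot : {dot H for Num.conj}) (dot_norm : induces_norm dot)
    (H_separable : separable H)
    (H_infinite : infinite_dimensional [set: H])
    (A : {linear H -> H}) (A_bounded : bounded_operator A)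
    (A_selfadjoint : self_adjoint dot A) :
  exists (alpha : 'I_5 -> R) (P : 'I_5 -> {linear H -> H}),
    (forall i, proper_orthoprojection dot (P i)) /\
    (forall x, A x = \sum_(i < 5) (alpha i)%:C *: P i x).
Proof.
have [lam [P [C [e [c [pP AC [sC bC] eo Ce]]]]]] :=
  eigenvector_reduction dot_norm A H_infinite A_bounded A_selfadjoint.
have [mu [nu [P1 [Q1 [P2 [Q2 [p1 q1 p2 q2 CS]]]]]]] :=
  eigenvector_sum_of_four dot_norm C e c H_separable sC bC eo Ce.
exists (fun i => nth 0 [:: lam; mu; mu; nu; nu] i),
  (fun i => nth P [:: P; P1; Q1; P2; Q2] i); split.
  by case; do 5?[case=> //].
by move=> x; rewrite AC CS !big_ord_recl big_ord0 /= addr0 !addrA.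
Qed.
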